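(* Consider $N$ non-redundant Euler-Lagrange agents $M_i(q_i)\ddot q_i+C_i(q_i,\dot q_i)\dot q_i+g_i(q_i)=f_i$, $q_i\in\mathbb{R}^n$, $i=1,\dots,N$, with uncertain constant parameter vectors $\theta_i$ ($\underline\theta_i\le\theta_i\le\overline\theta_i$), bounded actuation $f_i=\mathrm{Sat}_i(\hat f_i)$ saturating the $k$-th component at $\pm\bar f_i^k$, and time-varying communication delays $0\le T_{ji}(t)\le\overline T_{ji}$, where agent $i$ receives at time $t$ the information of agent $j$ from time $t-T_{ji}(t)$. Apply the control $$\hat f_i=\Phi_i(q_i,\dot q_i,e_i,\dot e_i)\hat\theta_i-\mathrm{Sat}^{pd}_i(\mu_is_i+e_i),\quad \dot{\hat\theta}_i=\mathrm{Proj}_{\hat\theta_i}(\omega_i),\quad \omega_i=-\beta_i\Phi_i^{\mathsf T}(q_i,\dot q_i,e_i,\dot e_i)s_i,$$ $$\ddot{\hat q}_i=\mathrm{Sat}^{pd}_i(e_i)-\sum_{j\in\mathcal{N}_i(0)}\nabla_i\psi(\|\hat q_{ijd}\|)-k_i\dot{\hat q}_i,$$ where $e_i=p_i\tilde q_i=p_i(q_i-\hat q_i)$, $s_i=\dot q_i+\alpha e_i$, $\hat q_{ijd}(t)=\hat q_i(t)-\hat q_j(t-T_{ji}(t))$, and $\mu_i,p_i,k_i,\alpha,\beta_i>0$ are constants, initialized with $\hat q_i(0)=q_i(0)$, $\dot{\hat q}_i(0)=0$, $\underline\theta_i\le\hat\theta_i(0)\le\overline\theta_i$. Suppose: (1)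 the initial communication graph is undirected and connected and $\|q_{ij}(0)\|\le r-\epsilon$ for all $(i,j)\in\mathcal{E}(0)$, for some $\epsilon>0$; (2) the agents start from rest, $\dot q_i(0)=0$ for all $i$; (3) the actuators can more than execute the dynamic compensations: $\eta_i^k<\bar f_i^k$ for all $i$ and $k=1,\dots,n$, where $\eta_i^k\ge0$ are constants bounding the absolute value of the $k$-th component of $\Phi_i(q_i,\dot q_i,e_i,\dot e_i)\hat\theta_i$; and $\mathrm{Sat}^{pd}_i$ saturates the $k$-th component at $\pm(\bar f_i^k-\eta_i^k)$; (4) the inter-proxy potential $\Psi(\hat q)$ is as in the context, is bounded, attains its maximum $\Psi_{max}=\phi^*$ whenever there is an edge $(i,j)\in\mathcal{E}(0)$ with $\|\hat q_{ij}\|=\hat r$, where $\hat r=r-\frac{2\epsilon}{3}$, and obeys $\Psi(\hat q(0))<\Psi_{max}$; (5) with $\zeta,\vartheta>0$ the constants in property (c) of the potential in the context, for some $a>0$ and $\upsilon_i>0$, $$k_i\ge\sum_{j\in\mathcal{N}_i(0)}\left(\frac{a(\zeta+\vartheta)}{2}+\frac{(\zeta+n\vartheta)\overline T_{ij}^2}{2a}\right)+\upsilon_i,\qquad i=1,\dots,N;$$ (6) the $\beta_i>0$ are such that $\sum_{i=1}^N\frac{1}{2\beta_i}\tilde\theta_i^{\mathsf T}(0)\tilde\theta_i(0)<\Psi_{max}-\Psi(\hat q(0))$, where $\tilde\theta_i=\theta_i-\hat\theta_i$ (such $\beta_i$ exist). Then the closed loop achieves connectivity-preserving consensus: $\|q_i(t)-q_j(t)\|<r$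 for all $t\ge0$ and all $(i,j)\in\mathcal{E}(0)$, and $q_i(t)-q_j(t)\to0$ as $t\to\infty$ for all $i,j$.
   Context: All agents have communication radius $r>0$; $\mathcal{E}(0)$ is the initial edge set, $\mathcal{N}_i(0)=\{j:(i,j)\in\mathcal{E}(0)\}$. Put $q_{ij}=q_i-q_j$, $\hat q_{ij}=\hat q_i-\hat q_j$, $\tilde q_i=q_i-\hat q_i$, $\hat q_{jd}(t)=\hat q_j(t-T_{ji}(t))$, $\hat q=(\hat q_1^{\mathsf T},\dots,\hat q_N^{\mathsf T})^{\mathsf T}$. $\nabla_i\psi(\|\hat q_{ij}\|)$ is the gradient with respect to $\hat q_i$, and $\nabla_i\psi(\|\hat q_{ijd}\|)$ is the same expression with $\hat q_j$ replaced by $\hat q_{jd}$. A superscript $k$ denotes the $k$-th component. Saturation at $\pm b$ ($b>0$) is $x\mapsto\max(-b,\min(b,x))$; $\mathrm{Sat}_i,\mathrm{Sat}^{pd}_i$ act componentwise. Properties of the Euler-Lagrange dynamics: P1. $M_i(q_i)$ is symmetric and $0\prec\lambda_{i1}I\preceq M_i(q_i)\preceq\lambda_{i2}I$ for constants $\lambda_{i1},\lambda_{i2}>0$; P2. $\dot M_i(q_i)-2C_i(q_i,\dot q_i)$ is skew-symmetric; P3. there is $c_i>0$ with $\|C_i(q_i,\dot q_i)y\|\le c_i\|\dot q_i\|\|y\|$ for all $q_i,\dot q_i,y$; P4. the dynamics are linear in the constant parameter vector $\theta_i$, with a regressor matrix of known functions; in particular $\Phi_i(q_i,\dot q_i,e_i,\dot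 e_i)\theta_i=M_i(q_i)(-\alpha\dot e_i)+C_i(q_i,\dot q_i)(-\alpha e_i)+g_i(q_i)$, and $\Phi_i(q_i,\dot q_i,e_i,\dot e_i)\hat\theta_i$ is the same expression with $\theta_i$ replaced by its estimate $\hat\theta_i$. Dynamic compensation bounds: constants $\eta_i^k$ as in (3) exist when $\underline\theta_i^k\le\hat\theta_i^k\le\overline\theta_i^k$ and $|\dot q_i^k|\le v_i^k$, $|\dot{\hat q}_i^k|\le\hat v_i^k$ for some constants $v_i^k,\hat v_i^k$. Projection (componentwise), with $0<\delta<\frac12(\overline\theta_i^k-\underline\theta_i^k)$: $\dot{\hat\theta}_i^k=(1-\upsilon_l(\hat\theta_i^k))\omega_i^k$ if $\underline\theta_i^k\le\hat\theta_i^k\le\underline\theta_i^k+\delta$ and $\omega_i^k<0$; $\dot{\hat\theta}_i^k=(1-\upsilon_u(\hat\theta_i^k))\omega_i^k$ if $\overline\theta_i^k-\delta\le\hat\theta_i^k\le\overline\theta_i^k$ and $\omega_i^k>0$; $\dot{\hat\theta}_i^k=\omega_i^k$ otherwise; here $\upsilon_l(\hat\theta_i^k)=\min\big(1,\frac{\underline\theta_i^k+\delta-\hat\theta_i^k}{\delta}\big)$ and $\upsilon_u(\hat\theta_i^k)=\min\big(1,\frac{\hat\theta_i^k-\overline\theta_i^k+\delta}{\delta}\big)$. Agent-proxy potential: $\phi_i(\tilde q_i)=\int_0^{\tilde q_i}\mathrm{Sat}^{pd}_i(p_i\sigma)\,d\sigma=\sum_{k=1}^n\int_0^{\tilde q_i^k}\mathrm{sat}^{pd}_{ik}(p_i\sigma_k)\,d\sigma_k$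 with $\mathrm{sat}^{pd}_{ik}$ the $k$-th component of $\mathrm{Sat}^{pd}_i$; $\phi_i^*=\min\{\phi_i(\tilde q_i):\|\tilde q_i\|=\epsilon/3\}$, $\phi^*=\min_{i=1,\dots,N}\phi_i^*$. Inter-proxy potential: $\Psi(\hat q)=\frac12\sum_{i=1}^N\sum_{j\in\mathcal{N}_i(0)}\psi(\|\hat q_{ij}\|)$, where (a) $\psi(\|\hat q_{ij}\|)\ge0$, and $\|\hat q_{ij}\|=0\Leftrightarrow\psi(\|\hat q_{ij}\|)=0$; (b) $\frac{\partial\psi(\|\hat q_{ij}\|)}{\partial\|\hat q_{ij}\|^2}$ exists and is positive at every point $\|\hat q_{ij}\|\in[0,\hat r)$; (c) if $|\hat q_{ij}^k|$ and $|\hat q_{ijd}^k|$ are bounded for all $k=1,\dots,n$, then there exist $\zeta>0$ and $\vartheta>0$ such that $$\big|\nabla_i^k\psi(\|\hat q_{ij}\|)-\nabla_i^k\psi(\|\hat q_{ijd}\|)\big|\le\zeta|\hat q_j^k-\hat q_{jd}^k|+\vartheta\,\bar q_j,\qquad \bar q_j=\|\hat q_j-\hat q_{jd}\|_\infty.$$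
   Formalization: The true parameters are assumed to lie at least δ inside their bounds (θ_lo+δ ≤ θ_i ≤ θ_up−δ, componentwise), since the claim can fail when θ_i lies in a layer where the projection acts; the remark that suitable β_i exist is not stated. *)

(* Defs.v *)
From HB Require Import structures.
From mathcomp Require Import all_boot all_order all_algebra.
From mathcomp Require Import all_classical all_reals all_analysis.

Set Implicit Arguments.
Unset Strict Implicit.
Unset Printing Implicit Defensive.

Import Order.TTheory GRing.Theory Num.Theory.
Import numFieldNormedType.Exports.

Local Open Scope classical_set_scope.
Local Open Scope ring_scope.

(* The library norm `|x| on 'cV[R]_n is the max norm; the Euclidean norm has to
   be introduced.  Below, enorm is ‖.‖ and `|.| is ‖.‖_∞. *)
Definition enorm (R : realType) (n : nat) (x : 'cV[R]_n) : R :=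
  Num.sqrt (\sum_(k < n) x k 0 ^+ 2).

Definition lecv (R : realType) (n : nat) (x y : 'cV[R]_n) : Prop :=
  forall k, x k 0 <= y k 0.

Definition sat (R : realType) (b x : R) : R := Num.max (- b) (Num.min b x).

Definition satv (R : realType) (n : nat) (b x : 'cV[R]_n) : 'cV[R]_n :=
  \col_k sat (b k 0) (x k 0).

Definition proj (R : realType) (lo up delta th w : R) : R :=
  if (lo <= th <= lo + delta) && (w < 0) then
    (1 - Num.min 1 ((lo + delta - th) / delta)) * w
  else if (up - delta <= th <= up) && (0 < w) then
    (1 - Num.min 1 ((th - up + delta) / delta)) * w
  else w.

Definition projv (R : realType) (m : nat) (lo up : 'cV[R]_m) (delta : R)
    (th w : 'cV[R]_m) : 'cV[R]_m :=
  \col_k proj (lo k 0) (up k 0) delta (th k 0) (w k 0).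

(* [regressor q v e e'] is Φ; it depends on the gain α used in P4. *)
Record el_agent (R : realType) (n m : nat) := ELAgent {
  inertia : 'cV[R]_n -> 'M[R]_n;
  coriolis : 'cV[R]_n -> 'cV[R]_n -> 'M[R]_n;
  gravity : 'cV[R]_n -> 'cV[R]_n;
  param : 'cV[R]_m;
  regressor : 'cV[R]_n -> 'cV[R]_n -> 'cV[R]_n -> 'cV[R]_n -> 'M[R]_(n, m)
}.

Section Agent.
Context (R : realType) (n m : nat) (A : el_agent R n m).

(* Matrix inequalities are in the sense of quadratic forms. *)
Definition P1 : Prop :=
  (forall q, (inertia A q)^T = inertia A q) /\
  exists l1 l2 : R, [/\ 0 < l1, 0 < l2 & forall q y : 'cV[R]_n,
    l1 * enorm y ^+ 2 <= (y^T *m inertia A q *m y) 0 0 <= l2 * enorm y ^+ 2].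

(* The time derivative of M(q) along a motion with velocity v is the
   differential of M at q in the direction v. *)
Definition P2 : Prop :=
  forall q v : 'cV[R]_n, differentiable (inertia A) q /\
    let S := 'd (inertia A) q v - 2 *: coriolis A q v in S^T = - S.

Definition P3 : Prop :=
  exists2 c : R, 0 < c & forall q v y : 'cV[R]_n,
    enorm (coriolis A q v *m y) <= c * enorm v * enorm y.

Definition P4 (alpha : R) : Prop :=
  forall q v e de : 'cV[R]_n,
    regressor A q v e de *m param A =
      inertia A q *m (- alpha *: de) + coriolis A q v *m (- alpha *: e)
      + gravity A q.

Definition el_properties (alpha : R) : Prop := [/\ P1, P2, P3 & P4 alpha].

End Agent.

(* Oriented integral from 0 to y, so that y may be negative. *)
Definition integral0 (R : realType) (f : R -> R) (y : R) : R :=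
  if 0 <= y then (\int[lebesgue_measure]_(s in `[0, y]) f s)%R
  else - (\int[lebesgue_measure]_(s in `[y, 0]) f s)%R.

(* Agent-proxy potential; b is the vector of levels of Sat^pd. *)
Definition phi (R : realType) (n : nat) (b : 'cV[R]_n) (p : R) (y : 'cV[R]_n)
    : R :=
  \sum_(k < n) integral0 (fun s => sat (b k 0) (p * s)) (y k 0).

(* A minimum: phi is continuous and the sphere is compact. *)
Definition phi_min (R : realType) (n : nat) (b : 'cV[R]_n) (p eps : R) : R :=
  inf [set phi b p y | y in [set y : 'cV[R]_n | enorm y = eps / 3]].

Definition phi_star (R : realType) (N n : nat) (b : 'I_N -> 'cV[R]_n)
    (p : 'I_N -> R) (eps : R) : R :=
  inf [set phi_min (b i) (p i) eps | i in [set: 'I_N]].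

Definition Psi (R : realType) (N n : nat) (E : rel 'I_N) (psi : R -> R)
    (y : 'I_N -> 'cV[R]_n) : R :=
  2^-1 * \sum_(i < N) \sum_(j < N | E i j) psi (enorm (y i - y j)).

(* Gradient of psi(‖x - y‖) with respect to x; the delayed gradient is the same
   expression evaluated at the delayed y. *)
Definition grad (R : realType) (n : nat) (psi : R -> R) (x y : 'cV[R]_n)
    : 'cV[R]_n :=
  \col_k 'D_(delta_mx k 0) (fun z : 'cV[R]_n => psi (enorm (z - y))) x.

(* The potential is only constrained on distances in [0, rhat].  In pot_deriv,
   the derivative is the one of s |-> psi (sqrt s) at s = d^2; it is one-sided
   at s = 0, where s ranges over squared distances. *)
Record potential (R : realType) (rhat : R) (psi : R -> R) : Prop := Potential {
  pot_cont : {within `[0, rhat], continuous psi};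
  pot_ge0 : forall d, 0 <= d <= rhat -> 0 <= psi d /\ (d = 0 <-> psi d = 0);
  pot_deriv : forall d, 0 <= d -> d < rhat -> exists2 l : R, 0 < l &
    (psi (Num.sqrt s) - psi d) / (s - d ^+ 2)
      @[s --> within [set s | 0 <= s] (d ^+ 2)^'] --> l
}.

(* x is the own position, y and z the current and the delayed position of a
   neighbour; B is the bound under which zeta and vartheta are valid. *)
Definition grad_bound (R : realType) (n : nat) (psi : R -> R)
    (B zeta vartheta : R) : Prop :=
  forall x y z : 'cV[R]_n,
    (forall k, `|x k 0 - y k 0| <= B) -> (forall k, `|x k 0 - z k 0| <= B) ->
    forall k, `|grad psi x y k 0 - grad psi x z k 0|
      <= zeta * `|y k 0 - z k 0| + vartheta * `|y - z|.

Record gains (R : realType) (N : nat) := Gains {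
  g_mu : 'I_N -> R;
  g_p : 'I_N -> R;
  g_k : 'I_N -> R;
  g_beta : 'I_N -> R;
  g_alpha : R
}.

Definition gains_pos (R : realType) (N : nat) (G : gains R N) : Prop :=
  0 < g_alpha G /\ forall i,
    [/\ 0 < g_mu G i, 0 < g_p G i, 0 < g_k G i & 0 < g_beta G i].

(* q, dq: agents; qh, dqh: proxies; thh: parameter estimates. *)
Record trajectory (R : realType) (N n : nat) (m : 'I_N -> nat) := Trajectory {
  q : 'I_N -> R -> 'cV[R]_n;
  dq : 'I_N -> R -> 'cV[R]_n;
  qh : 'I_N -> R -> 'cV[R]_n;
  dqh : 'I_N -> R -> 'cV[R]_n;
  thh : forall i : 'I_N, R -> 'cV[R]_(m i)
}.

Section ClosedLoop.
Context (R : realType) (N n : nat) (m : 'I_N -> nat).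
Context (A : forall i, el_agent R n (m i)) (thlo thup : forall i, 'cV[R]_(m i)).
Context (delta : R) (fbar eta : 'I_N -> 'cV[R]_n).
Context (E : rel 'I_N) (T : 'I_N -> 'I_N -> R -> R) (psi : R -> R).
Context (G : gains R N) (x : trajectory R n m).

Definition err i (t : R) : 'cV[R]_n := g_p G i *: (q x i t - qh x i t).
Definition derr i (t : R) : 'cV[R]_n := g_p G i *: (dq x i t - dqh x i t).
Definition surf i (t : R) : 'cV[R]_n := dq x i t + g_alpha G *: err i t.

Definition Phi i (t : R) : 'M[R]_(n, m i) :=
  regressor (A i) (q x i t) (dq x i t) (err i t) (derr i t).

Definition satpd i (y : 'cV[R]_n) : 'cV[R]_n := satv (fbar i - eta i) y.

Definition fhat i (t : R) : 'cV[R]_n :=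
  Phi i t *m thh x i t - satpd i (g_mu G i *: surf i t + err i t).

Definition omega i (t : R) : 'cV[R]_(m i) :=
  - g_beta G i *: ((Phi i t)^T *m surf i t).

(* Classical solution on [0, +oo[: continuous there, with the differential
   equations holding at every t > 0 (two-sided derivatives are not available at
   t = 0).  T j i is the delay from j to i.  Before t = 0 the proxies rest at
   their initial positions, which gives a meaning to the delayed positions when
   T j i t > t. *)
Record closed_loop : Prop := ClosedLoop {
  cl_cont : forall i,
    [/\ {within `[0, +oo[, continuous (q x i)},
        {within `[0, +oo[, continuous (dq x i)},
        {within `[0, +oo[, continuous (qh x i)},
        {within `[0, +oo[, continuous (dqh x i)} &
        {within `[0, +oo[, continuous (thh x i)}];
  cl_q : forall i (t : R), 0 < t -> is_derive t (1 : R) (q x i) (dq x i t);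
  cl_dq : forall i (t : R), 0 < t ->
    exists2 ddq : 'cV[R]_n, is_derive t (1 : R) (dq x i) ddq &
      inertia (A i) (q x i t) *m ddq
      + coriolis (A i) (q x i t) (dq x i t) *m dq x i t
      + gravity (A i) (q x i t) = satv (fbar i) (fhat i t);
  cl_qh : forall i (t : R), 0 < t -> is_derive t (1 : R) (qh x i) (dqh x i t);
  cl_dqh : forall i (t : R), 0 < t -> is_derive t (1 : R) (dqh x i)
    (satpd i (err i t)
     - \sum_(j < N | E i j) grad psi (qh x i t) (qh x j (t - T j i t))
     - g_k G i *: dqh x i t);
  cl_thh : forall i (t : R), 0 < t -> is_derive t (1 : R) (thh x i)
    (projv (thlo i) (thup i) delta (thh x i t) (omega i t));
  cl_qh0 : forall i, qh x i 0 = q x i 0;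
  cl_dqh0 : forall i, dqh x i 0 = 0;
  cl_thh0 : forall i, lecv (thlo i) (thh x i 0) /\ lecv (thh x i 0) (thup i);
  cl_past : forall i (t : R), t < 0 -> qh x i t = qh x i 0
}.

End ClosedLoop.

(* Main.v *)
Require Import Defs.
From HB Require Import structures.
From mathcomp Require Import all_boot all_order all_algebra.
From mathcomp Require Import all_classical all_reals all_analysis.
From mathcomp Require Import ring lra.
Set Implicit Arguments.
Unset Strict Implicit.
Unset Printing Implicit Defensive.
Import Order.TTheory GRing.Theory Num.Theory.
Import numFieldNormedType.Exports.
Local Open Scope classical_set_scope.
Local Open Scope ring_scope.

(** The proof is a Lyapunov-Krasovskii argument. The energy [lyapunov] adds, over
    the agents, the inertia-weighted square of the sliding variable
    [s_i = dq_i + alpha e_i], the parameter error weighted by [1 / beta_i], the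
    kinetic energy of the proxy and the agent-proxy potential [phi]; then the
    inter-proxy potential [Psi]; then, for every edge, a delay functional
    ([krasovskii]) built from the squared speed of the neighbour's proxy.

    Along the closed loop, skew-symmetry of [dM/dt - 2 C], linearity in the
    parameters and the projection leave only the saturated feedback
    ([agent_energy_der]). The powers exchanged through [phi] and [Psi] cancel,
    except for the difference between the undelayed and the delayed gradients;
    the Lipschitz bound on the gradient, Young's inequality and Cauchy-Schwarz in
    time ([displacement_le], [perturbation_power]) bound its power by terms which
    the delay functional and the damping gains absorb. Hence the energy decreases
    at a rate at least [sum_i alpha Sat(e_i).e_i + upsilon_i |dqh_i|^2]
    ([lyapunov_der]), as long as the edges between proxies stay shorter than
    [rhat] and the proxies are slow enough for the gradient bound to apply.

    The initial energy is below [Psimax = phi_star]. By induction on time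
    ([admissible_forever]) it stays so, and no edge between proxies can reach
    [rhat], since [Psi] would then be at least [Psimax]; for the same reason
    every agent stays within [eps / 3] of its proxy. The triangle inequality gives
    the preservation of connectivity ([connectivity]).

    For consensus, Barbalat's lemma gives [e_i -> 0] and [dqh_i -> 0], their
    derivatives being bounded. A second lemma of the same kind
    ([barbalat_deriv]), applied to the proxy dynamics, shows that the total
    undelayed force on each proxy vanishes; it needs no regularity of the delays,
    which only contribute a vanishing displacement. Testing the forces against
    relative positions ([virial]) makes the sum over the edges of [rho(d) d]
    vanish, where [d] is the length of the edge and [rho] the derivative of
    [psi] with respect to the distance. Since [rho] is positive and continuous on
    [(0, rhat)] and the lengths stay away from [rhat] ([edge_gap]), the lengths
    tend to [0], and connectedness of the graph concludes. *)

Section RealDerivatives.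
Context {R : realType}.
Implicit Types (f g : R -> R) (t a b c : R).

Lemma der_eq f a b t : is_derive t 1 f a -> a = b -> is_derive t 1 f b.
Proof. by move=> df <-. Qed.

Lemma der_cst c t : is_derive t 1 (fun _ : R => c) 0.
Proof. exact: is_derive_cst. Qed.

Lemma der_id t : is_derive t 1 (fun u : R => u) 1.
Proof. exact: is_derive_id. Qed.

Lemma derD f g a b t : is_derive t 1 f a -> is_derive t 1 g b ->
  is_derive t 1 (fun u => f u + g u) (a + b).
Proof. exact: is_deriveD. Qed.

Lemma derB f g a b t : is_derive t 1 f a -> is_derive t 1 g b ->
  is_derive t 1 (fun u => f u - g u) (a - b).
Proof. exact: is_deriveB. Qed.

Lemma derM f g a b t : is_derive t 1 f a -> is_derive t 1 g b ->
  is_derive t 1 (fun u => f u * g u) (a * g t + f t * b).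
Proof.
move=> df dg; refine (der_eq (is_deriveM df dg) _).
by rewrite /GRing.scale /= addrC; congr (_ + _); rewrite mulrC.
Qed.

Lemma derZ c f a t : is_derive t 1 f a -> is_derive t 1 (fun u => c * f u) (c * a).
Proof. by move=> df; refine (der_eq (derM (der_cst c t) df) _); ring. Qed.

Lemma der_sum (I : Type) (r : seq I) (P : pred I) (F : I -> R -> R)
    (dF : I -> R) t :
  (forall i, P i -> is_derive t 1 (F i) (dF i)) ->
  is_derive t 1 (fun u => \sum_(i <- r | P i) F i u) (\sum_(i <- r | P i) dF i).
Proof.
move=> dFt; elim: r => [|i r IH].
  rewrite big_nil; under eq_fun do rewrite big_nil; exact: der_cst.
rewrite big_cons; under eq_fun do rewrite big_cons.
by case: ifPn => // Pi; apply: derD => //; exact: dFt.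
Qed.

Lemma der_comp f g a b t : is_derive (g t) 1 f a -> is_derive t 1 g b ->
  is_derive t 1 (fun u => f (g u)) (a * b).
Proof. move=> df dg; exact: (is_derive1_comp df dg). Qed.

Lemma der_near f g a t : (\forall u \near t, f u = g u) ->
  is_derive t 1 f a -> is_derive t 1 g a.
Proof. by move=> fg; apply: near_eq_is_derive. Qed.

Lemma der_continuous f a t : is_derive t 1 f a -> {for t, continuous f}.
Proof.
by move=> [df _]; apply: differentiable_continuous; apply/derivable1_diffP.
Qed.

Lemma continuous_bigsum (I : Type) (r : seq I) (P : pred I) (F : I -> R -> R) :
  (forall i, P i -> continuous (F i)) ->
  continuous (fun u => \sum_(i <- r | P i) F i u).
Proof.
move=> cF u; elim: r => [|i r IH].
  by under eq_fun do rewrite big_nil; exact: cst_continuous.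
under eq_fun do rewrite big_cons; case: ifPn => // Pi.
by apply: continuousD => //; exact: cF.
Qed.

(** Mean value inequality. *)
Lemma der_le f c a b : a <= b -> {within `[a, b], continuous f} ->
  (forall t, a < t < b -> exists2 d, is_derive t 1 f d & d <= c) ->
  f b - f a <= c * (b - a).
Proof.
rewrite le_eqVlt => /predU1P[-> _ _|ab fc fd]; first by rewrite !subrr mulr0.
have dfd t : t \in `]a, b[ -> is_derive t 1 f (derive1 f t) /\ derive1 f t <= c.
  rewrite in_itv/= => /fd[d df dc].
  have E : derive1 f t = d by rewrite derive1E derive_val.
  by rewrite E.
have [t tab ->] := MVT ab (fun t tab => (dfd t tab).1) fc.
by rewrite ler_wpM2r ?subr_ge0 ?(ltW ab)//; exact: (dfd t tab).2.
Qed.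

Lemma der_ge f c a b : a <= b -> {within `[a, b], continuous f} ->
  (forall t, a < t < b -> exists2 d, is_derive t 1 f d & c <= d) ->
  c * (b - a) <= f b - f a.
Proof.
move=> ab fc fd.
have h : - f b - - f a <= - c * (b - a); last by move: h; lra.
apply: (@der_le (fun u => - f u)) => //.
  by move=> t; apply: continuousN; exact: fc.
move=> t /fd[d df cd]; exists (- d); last by rewrite lerN2.
exact: is_deriveN.
Qed.

(** The oriented integral is a primitive of a continuous function. *)
Lemma primitive_der f t : continuous f -> is_derive t 1 (Defs.integral0 f) (f t).
Proof.
move=> fc.
have fi a b : lebesgue_measure.-integrable `[a, b] (EFin \o f).
  apply: continuous_compact_integrable; first exact: segment_compact.
  exact: continuous_subspaceT.
(* A base point below both 0 and [t] turns the oriented integral into a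
   difference of ordinary ones. *)
pose a := - `|t| - 1.
have a0 : a < 0 by rewrite /a; have := normr_ge0 t; lra.
have at' : a < t by rewrite /a; have := ler_norm (- t); rewrite normrN; lra.
pose F y := (\int[lebesgue_measure]_(s in `[a, y]) f s)%R.
have E y : a < y -> Defs.integral0 f y = F y - F 0.
  move=> ay; rewrite /Defs.integral0; case: leP => y0.
    rewrite [RHS]Rintegral_itvB ?bnd_simp// ?(ltW a0)//.
    rewrite Rintegral_itv_obnd_cbnd//.
    by apply: integrableS (fi 0 y) => //; exact: subset_itv_oc_cc.
  rewrite -[RHS]opprB [F 0 - _]Rintegral_itvB ?bnd_simp ?(ltW ay) ?(ltW y0)//.
  rewrite Rintegral_itv_obnd_cbnd//.
  by apply: integrableS (fi y 0) => //; exact: subset_itv_oc_cc.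
apply: (@der_near (fun y => F y - F 0)).
  near=> y; rewrite E//; near: y; exact: lt_nbhsr.
have [dF F'] := @continuous_FTC1_closed _ f a t (t + 1) (ltr_pwDr ltr01 (lexx t))
  (fi _ _) at' (fc t).
have dFt : is_derive t 1 F (f t) := DeriveDef dF (etrans (esym (derive1E _ _)) F').
by refine (der_eq (derB dFt (der_cst (F 0) t)) _); rewrite subr0.
Unshelve. all: by end_near. Qed.

Lemma integral00 f : Defs.integral0 f 0 = 0.
Proof. by rewrite /Defs.integral0 lexx set_itv1 Rintegral_set1. Qed.

End RealDerivatives.


(** * Asymptotic behaviour of signals *)

Section Asymptotics.
Context {R : realType}.
Implicit Types (f g L : R -> R) (s t u d e h k D : R).

(** Induction on the half-line: a property that propagates to the right end of
    intervals and is open holds forever. *)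
Lemma real_induction (P : R -> Prop) : P 0 ->
  (forall t, 0 < t -> (forall s, 0 <= s < t -> P s) -> P t) ->
  (forall t, 0 <= t -> P t -> \forall s \near t, P s) ->
  forall t, 0 <= t -> P t.
Proof.
move=> P0 Pclosed Popen t t0; apply: contrapT => nPt.
pose S := [set s | 0 <= s /\ ~ P s].
have St : S t by [].
have S0 : has_inf S by split; [exists t | exists 0 => s []].
have infS0 : 0 <= inf S by apply: lb_le_inf; [exists t | move=> s []].
have below s : 0 <= s < inf S -> P s.
  move=> /andP[s0 sinf]; apply: contrapT => nPs.
  by move: sinf; rewrite ltNge => /negP; apply; apply: ge_inf; [case: S0|].
have Pinf : P (inf S).
  move: infS0; rewrite le_eqVlt => /predU1P[<-//|infS0]; exact: Pclosed.
have [/= e e0 eP] := Popen _ infS0 Pinf.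
have [s Ss se] := inf_adherent e0 S0; have [s0 nPs] := Ss.
apply: nPs; apply: eP; rewrite /= ler0_norm; first by move: se; lra.
by rewrite subr_le0; apply: ge_inf; [case: S0|].
Qed.

(** [f] tends to [0] at [+oo]. *)
Definition vanishes f :=
  forall e, 0 < e -> exists T, forall t, T <= t -> `|f t| <= e.

Lemma vanishes_near f g (T0 : R) :
  (forall t, T0 <= t -> f t = g t) -> vanishes f -> vanishes g.
Proof.
move=> fg vf e /vf[T fT]; exists (Num.max T T0) => t.
by rewrite ge_max => /andP[Tt T0t]; rewrite -fg// fT.
Qed.

Lemma vanishes_le f g c (T0 : R) : 0 <= c ->
  (forall t, T0 <= t -> `|g t| <= c * `|f t|) -> vanishes f -> vanishes g.
Proof.
move=> c0 gf vf e e0; have [|T fT] := vf (e / (c + 1)).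
  by rewrite divr_gt0// ltr_wpDl.
exists (Num.max T T0) => t; rewrite ge_max => /andP[Tt T0t].
apply: (le_trans (gf _ T0t)); apply: (le_trans (ler_wpM2l c0 (fT _ Tt))).
rewrite mulrA ler_pdivrMr ?ltr_wpDl// mulrC; nra.
Qed.

Lemma vanishes0 : vanishes (fun=> 0).
Proof. by move=> e e0; exists 0 => t _; rewrite normr0 ltW. Qed.

Lemma vanishesD f g : vanishes f -> vanishes g -> vanishes (fun t => f t + g t).
Proof.
move=> vf vg e e0; have e2 : 0 < e / 2 by lra.
have [S fS] := vf _ e2; have [T gT] := vg _ e2.
exists (Num.max S T) => t; rewrite ge_max => /andP[/fS ft /gT gt].
by have := ler_normD (f t) (g t); lra.
Qed.

Lemma vanishes_sum (I : Type) (r : seq I) (P : pred I) (F : I -> R -> R) :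
  (forall i, P i -> vanishes (F i)) ->
  vanishes (fun t => \sum_(i <- r | P i) F i t).
Proof.
move=> vF; elim: r => [|i r IH].
  by apply: (vanishes_near (T0 := 0) _ vanishes0) => t _; rewrite big_nil.
have vFi : vanishes (fun t => if P i then F i t else 0).
  by have := vF i; case: (P i) => [/(_ isT)//|_]; exact: vanishes0.
apply: (vanishes_near (T0 := 0) _ (vanishesD vFi IH)) => t _.
by rewrite big_cons; case: ifP; rewrite ?add0r.
Qed.

Lemma vanishes_norm f : vanishes f -> vanishes (fun t => `|f t|).
Proof. by move=> vf e /vf[T fT]; exists T => t /fT; rewrite normr_id. Qed.

Lemma vanishesZ c f : vanishes f -> vanishes (fun t => c * f t).
Proof.
by apply: (vanishes_le (c := `|c|) (T0 := 0)) => // t _; rewrite normrM.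
Qed.

(** Barbalat's lemma in Lyapunov form: a Lipschitz signal vanishes as soon as a
    nonincreasing function that is bounded below decreases at a definite rate
    while the signal is not small. *)
Lemma barbalat L f m D : 0 < D ->
  (forall t, 0 <= t -> m <= L t) ->
  (forall s t, 0 <= s -> s <= t -> L t <= L s) ->
  (forall s t, 0 <= s -> s <= t -> `|f t - f s| <= D * (t - s)) ->
  (forall e, 0 < e -> exists2 k, 0 < k & forall s t, 0 <= s -> s <= t ->
     (forall u, s < u < t -> e <= `|f u|) -> L t - L s <= - k * (t - s)) ->
  vanishes f.
Proof.
move=> D0 Lm Lni fD Ldec e e0.
have [|k k0 Lk] := Ldec (e / 2); first by lra.
(* A value at least [e] keeps the signal above [e / 2] for a time [h]. *)
pose h := e / (2 * D).
have h0 : 0 < h by rewrite divr_gt0// mulr_gt0.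
have Dh : D * h = e / 2 by rewrite /h; field; rewrite gt_eqF.
have hiL : has_inf [set L t | t in [set t | 0 <= t]].
  by split; [exists (L 0); exists 0 => //= | exists m => _ [t t0 <-]; exact: Lm].
have [_ [T /= T0 <-] LT] := inf_adherent (mulr_gt0 k0 h0) hiL.
exists T => t Tt; rewrite leNgt; apply/negP => et.
have t0 : 0 <= t by exact: le_trans Tt.
have : L (t + h) - L t <= - k * (t + h - t).
  apply: Lk => //; first by rewrite lerDl ltW.
  move=> u /andP[tu uth]; have := fD t u t0 (ltW tu).
  have := ler_wpM2l (ltW D0) (_ : u - t <= h); rewrite Dh => /(_ _) H.
  have {}H : D * (u - t) <= e / 2 by apply: H; lra.
  have := ler_normD (f t - f u) (f u); rewrite subrK distrC.
  lra.
have : inf [set L t | t in [set t | 0 <= t]] <= L (t + h).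
  by apply: ge_inf; [case: hiL | exists (t + h) => //=; rewrite addr_ge0// ltW].
have := Lni T t T0 Tt.
move: LT; rewrite addrAC subrr add0r mulNr; lra.
Qed.

(** If [f] vanishes and its derivative is asymptotic to a Lipschitz function,
    then that function vanishes too. *)
Lemma barbalat_deriv f g D : 0 < D -> vanishes f ->
  (forall s t, 0 <= s -> s <= t -> `|g t - g s| <= D * (t - s)) ->
  (forall e, 0 < e -> exists T, forall t, T <= t ->
     exists2 d, is_derive t 1 f d & `|d - g t| <= e) ->
  vanishes g.
Proof.
move=> D0 vf gD fg.
(* The upper bound suffices, since the hypotheses are invariant under negation. *)
suff up f' g' : vanishes f' ->
    (forall s t, 0 <= s -> s <= t -> `|g' t - g' s| <= D * (t - s)) ->
    (forall e, 0 < e -> exists T, forall t, T <= t ->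
       exists2 d, is_derive t 1 f' d & `|d - g' t| <= e) ->
    forall e, 0 < e -> exists T, forall t, T <= t -> g' t <= e.
  move=> e e0; have [T gT] := up _ _ vf gD fg e e0.
  have [|||T' gT'] := up (fun t => - f t) (fun t => - g t) _ _ _ e e0.
  - by move=> d /vf[S fS]; exists S => t /fS; rewrite normrN.
  - by move=> s t s0 st; rewrite -opprD normrN gD.
  - move=> d /fg[S fS]; exists S => t /fS[u dfu ud]; exists (- u).
      exact: is_deriveN.
    by rewrite -opprD normrN.
  exists (Num.max T T') => t; rewrite ge_max => /andP[/gT gt /gT' gt'].
  by rewrite ler_norml gt andbT; lra.
move=> {}vf {}gD {}fg e e0.
pose h := e / (2 * D).
have h0 : 0 < h by rewrite divr_gt0// mulr_gt0.
have Dh : D * h = e / 2 by rewrite /h; field; rewrite gt_eqF.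
have e4 : 0 < e / 4 by lra.
have [T fT] := fg _ e4.
have [|S fS] := vf (e * h / 16); first by rewrite divr_gt0// mulr_gt0.
exists (Num.max 0 (Num.max S T)) => t; rewrite !ge_max => /and3P[t0 St Tt].
rewrite leNgt; apply/negP => egt.
have df u : t <= u -> exists2 d, is_derive u 1 f' d & `|d - g' u| <= e / 4.
  by move=> tu; apply: fT; exact: le_trans tu.
have : e / 4 * (t + h - t) <= f' (t + h) - f' t.
  apply: der_ge; first by rewrite lerDl ltW.
    apply: derivable_within_continuous => u; rewrite in_itv/= => /andP[tu _].
    by have [d [dfu _] _] := df u tu.
  move=> u /andP[tu uth]; have [d dfu du] := df u (ltW tu).
  exists d => //; have := gD t u t0 (ltW tu).
  have H : D * (u - t) <= e / 2 by rewrite -Dh ler_wpM2l ?(ltW D0)//; lra.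
  rewrite ler_distl => /andP[gu _].
  move: du; rewrite ler_distl => /andP[du _]; lra.
have := fS t St; have := fS (t + h); rewrite (le_trans St) ?lerDl ?(ltW h0)// => /(_ isT).
rewrite !ler_norml => /andP[_ A] /andP[A' _].
have : 0 < e * h by rewrite mulr_gt0.
move: A A'; rewrite (_ : t + h - t = h); last by ring.
nra.
Qed.

End Asymptotics.


(** * Euclidean geometry of column vectors *)

Section EuclideanGeometry.
Context {R : realType} {n : nat}.
Implicit Types (u v w : 'cV[R]_n) (c : R).

(** Scalar product of column vectors. *)
Definition dot u v : R := \sum_k u k 0 * v k 0.

Lemma colB u v k : (u - v) k 0 = u k 0 - v k 0.
Proof. by rewrite !mxE. Qed.

Lemma dotE u v : (u^T *m v) 0 0 = dot u v.
Proof. by rewrite mxE; apply: eq_bigr => k _; rewrite mxE. Qed.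

Lemma dotC u v : dot u v = dot v u.
Proof. by apply: eq_bigr => k _; rewrite mulrC. Qed.

Lemma dotDl u v w : dot (u + v) w = dot u w + dot v w.
Proof. by rewrite /dot -big_split; apply: eq_bigr => k _; rewrite mxE mulrDl. Qed.

Lemma dotZl c u v : dot (c *: u) v = c * dot u v.
Proof. by rewrite /dot mulr_sumr; apply: eq_bigr => k _; rewrite mxE mulrA. Qed.

Lemma dotNl u v : dot (- u) v = - dot u v.
Proof. by rewrite -scaleN1r dotZl mulN1r. Qed.

Lemma dotBl u v w : dot (u - v) w = dot u w - dot v w.
Proof. by rewrite dotDl dotNl. Qed.

Lemma dotDr u v w : dot w (u + v) = dot w u + dot w v.
Proof. by rewrite dotC dotDl !(dotC w). Qed.

Lemma dotZr c u v : dot u (c *: v) = c * dot u v.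
Proof. by rewrite dotC dotZl dotC. Qed.

Lemma dotNr u v : dot u (- v) = - dot u v.
Proof. by rewrite dotC dotNl dotC. Qed.

Lemma dotBr u v w : dot w (u - v) = dot w u - dot w v.
Proof. by rewrite dotDr dotNr. Qed.

Lemma dot_sumr (I : Type) (r : seq I) (P : pred I) (F : I -> 'cV[R]_n) u :
  dot u (\sum_(i <- r | P i) F i) = \sum_(i <- r | P i) dot u (F i).
Proof.
rewrite /dot exchange_big /=; apply: eq_bigr => k _.
by rewrite summxE mulr_sumr.
Qed.

Lemma dot_ge0 u : 0 <= dot u u.
Proof. by apply: sumr_ge0 => k _; rewrite -expr2 sqr_ge0. Qed.

Lemma enormE u : enorm u = Num.sqrt (dot u u).
Proof. by rewrite /enorm /dot; under eq_bigr do rewrite expr2. Qed.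

Lemma enorm_ge0 u : 0 <= enorm u.
Proof. exact: sqrtr_ge0. Qed.

Lemma sqr_enorm u : enorm u ^+ 2 = dot u u.
Proof. by rewrite enormE sqr_sqrtr// dot_ge0. Qed.

Lemma coord_enorm u k : `|u k 0| <= enorm u.
Proof.
rewrite -(@ler_pXn2r _ 2)// ?nnegrE ?enorm_ge0// sqr_enorm real_normK ?num_real//.
rewrite /dot (bigD1 k)//= expr2 lerDl.
by apply: sumr_ge0 => j _; rewrite -expr2 sqr_ge0.
Qed.

Lemma sqr_coord_le u k : u k 0 ^+ 2 <= dot u u.
Proof.
by rewrite -sqr_enorm -real_normK ?num_real// ler_pXn2r ?nnegrE ?enorm_ge0 ?coord_enorm.
Qed.

Lemma enorm0 : enorm (0 : 'cV[R]_n) = 0.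
Proof. by rewrite enormE /dot big1 ?sqrtr0// => k _; rewrite mxE mulr0. Qed.

Lemma enormZ c u : enorm (c *: u) = `|c| * enorm u.
Proof. by rewrite !enormE dotZl dotZr mulrA -expr2 sqrtrM ?sqr_ge0// sqrtr_sqr. Qed.

Lemma enormN u : enorm (- u) = enorm u.
Proof. by rewrite -scaleN1r enormZ normrN1 mul1r. Qed.

Lemma enormC u v : enorm (u - v) = enorm (v - u).
Proof. by rewrite -opprB enormN. Qed.

Lemma enorm_eq0 u : enorm u = 0 -> u = 0.
Proof.
move=> u0; apply/colP => k; apply/eqP; rewrite mxE -normr_eq0 eq_le normr_ge0 andbT.
by rewrite -u0 coord_enorm.
Qed.

Lemma dot_enorm u v : dot u v <= enorm u * enorm v.
Proof.
have [/enorm_eq0->|u0] := eqVneq (enorm u) 0.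
  by rewrite enorm0 mul0r -(scale0r (0 : 'cV[R]_n)) dotZl mul0r.
have [/enorm_eq0->|v0] := eqVneq (enorm v) 0.
  by rewrite enorm0 mulr0 -(scale0r (0 : 'cV[R]_n)) dotZr mul0r.
have {}u0 : 0 < enorm u by rewrite lt_def u0 enorm_ge0.
have {}v0 : 0 < enorm v by rewrite lt_def v0 enorm_ge0.
(* Cauchy-Schwarz, from the square of [|v| u - |u| v]. *)
have := dot_ge0 (enorm v *: u - enorm u *: v).
rewrite !(dotBl, dotBr, dotZl, dotZr) (dotC v u) -!sqr_enorm.
have := mulr_gt0 u0 v0.
set a := enorm u; set b := enorm v; set d := dot u v => ab.
rewrite (_ : _ - _ = 2 * (a * b) * (a * b - d)); last by ring.
by rewrite pmulr_rge0 ?subr_ge0// mulr_gt0.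
Qed.

Lemma enormD u v : enorm (u + v) <= enorm u + enorm v.
Proof.
rewrite -(@ler_pXn2r _ 2)// ?nnegrE ?addr_ge0 ?enorm_ge0//.
rewrite sqr_enorm !(dotDl, dotDr) (dotC v u) sqrrD !sqr_enorm.
have := dot_enorm u v; lra.
Qed.

Lemma coord_norm u k : `|u k 0| <= `|u|.
Proof. by rewrite [leRHS]/Num.norm/= mx_normrE; exact: (le_bigmax _ _ (k, 0)). Qed.

Lemma norm_le u c : 0 <= c -> (forall k, `|u k 0| <= c) -> `|u| <= c.
Proof.
move=> c0 uc; rewrite [leLHS]/Num.norm/= mx_normrE.
by apply/bigmax_leP; split => // -[k j] _ /=; rewrite ord1.
Qed.

Lemma norm_le_enorm u : `|u| <= enorm u.
Proof. by apply: norm_le; [exact: enorm_ge0 | exact: coord_enorm]. Qed.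

Lemma norm_sq_le u c : (forall k, u k 0 ^+ 2 <= c) -> 0 <= c -> `|u| ^+ 2 <= c.
Proof.
move=> uc c0; rewrite -(sqr_sqrtr c0) ler_pXn2r ?nnegrE ?sqrtr_ge0//.
apply: norm_le => [|k]; first exact: sqrtr_ge0.
by rewrite -sqrtr_sqr ler_wsqrtr.
Qed.

End EuclideanGeometry.

(** * Saturation and projection *)

Section Saturation.
Context {R : realType}.
Implicit Types (b x y p lo up delta th w : R).

(* Reduces a goal about saturations to linear arithmetic, case by case. *)
Ltac sat_cases := rewrite /sat ?minEle ?maxEle;
  repeat match goal with |- context [if ?a <= ?b then _ else _] =>
    lazymatch a with context [if _ then _ else _] => fail | _ =>
    lazymatch b with context [if _ then _ else _] => fail | _ =>
      case: (boolP (a <= b)); [move=> ? | rewrite -ltNge => ?] end end end.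

Lemma sat_le b x y : x <= y -> sat b x <= sat b y.
Proof. by move=> xy; sat_cases; lra. Qed.

Lemma sat_abs b x : 0 <= b -> `|sat b x| <= b.
Proof. by move=> b0; rewrite ler_norml; apply/andP; split; sat_cases; lra. Qed.

Lemma sat_id b x : `|x| <= b -> sat b x = x.
Proof. by rewrite ler_norml => /andP[? ?]; sat_cases; lra. Qed.

Lemma sat0 b : 0 <= b -> sat b 0 = 0.
Proof. by move=> b0; rewrite sat_id// normr0. Qed.

Lemma sat_contract b x : 0 <= b -> `|sat b x| <= `|x|.
Proof.
by move=> b0; rewrite ler_norml; apply/andP; split;
  have := ler_norm x; have := ler_norm (- x); rewrite normrN; sat_cases; lra.
Qed.

Lemma sat_ge0 b x : 0 <= b -> 0 <= x -> 0 <= sat b x.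
Proof. by move=> b0 /(sat_le b); rewrite sat0. Qed.

Lemma sat_le0 b x : 0 <= b -> x <= 0 -> sat b x <= 0.
Proof. by move=> b0 /(sat_le b); rewrite sat0. Qed.

Lemma sat_mul_ge0 b x : 0 <= b -> 0 <= sat b x * x.
Proof.
move=> b0; have [x0|/ltW x0] := leP 0 x; first by rewrite mulr_ge0 ?sat_ge0.
by rewrite -mulrNN mulr_ge0 ?oppr_ge0 ?sat_le0.
Qed.

Lemma sat_mul_min b x y : 0 <= b -> 0 <= y -> y <= `|x| ->
  Num.min b y * y <= sat b x * x.
Proof.
move=> b0 y0; rewrite ler_normr => /orP[] xy.
  by sat_cases; nra.
by sat_cases; nra.
Qed.

Lemma continuous_sat b : continuous (sat b).
Proof.
move=> x; apply: (@continuous_max _ _ (fun=> - b) (fun x => Num.min b x)).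
  exact: cst_continuous.
apply: (@continuous_min _ _ (fun=> b) id) => //; exact: cst_continuous.
Qed.

(** The part of the update that the projection removes points away from the true
    parameter. *)
Lemma proj_descent lo up delta th th0 w : 0 < delta ->
  lo + delta <= th0 <= up - delta ->
  (th0 - th) * (w - Defs.proj lo up delta th w) <= 0.
Proof.
move=> d0 /andP[loth thup]; rewrite /Defs.proj.
case: ifPn => [/andP[/andP[a b] w0]|_].
  set m := Num.min _ _; have m0 : 0 <= m.
    by rewrite le_min ler01 divr_ge0 ?(ltW d0)//; lra.
  rewrite (_ : _ * _ = m * ((th0 - th) * w)); last by ring.
  by apply: mulr_ge0_le0 => //; apply: mulr_ge0_le0; lra.
case: ifPn => [/andP[/andP[a b] w0]|_]; last by rewrite subrr mulr0.
set m := Num.min _ _; have m0 : 0 <= m.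
  by rewrite le_min ler01 divr_ge0 ?(ltW d0)//; lra.
rewrite (_ : _ * _ = m * ((th0 - th) * w)); last by ring.
by apply: mulr_ge0_le0 => //; apply: mulr_le0_ge0; lra.
Qed.

End Saturation.


(** * Derivatives of matrix-valued functions *)

Section MatrixDerivatives.
Context {R : realType}.

(** Entrywise derivative of a matrix-valued function of time. *)
Definition mxder m n (M : R -> 'M[R]_(m, n)) (t : R) (dM : 'M[R]_(m, n)) : Prop :=
  forall i j, is_derive t 1 (fun u => M u i j) (dM i j).

Lemma is_derive_mxder m n (M : R -> 'M[R]_(m, n)) t dM :
  is_derive t (1 : R) M dM -> mxder M t dM.
Proof.
move=> [dMt <-] i j; rewrite derive_mx// mxE.
by apply: derivableP; exact: (derivable_mxP _ _ _).1.
Qed.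

Lemma mxderM m n p (A : R -> 'M[R]_(m, n)) (B : R -> 'M[R]_(n, p)) t dA dB :
  mxder A t dA -> mxder B t dB ->
  mxder (fun u => A u *m B u) t (dA *m B t + A t *m dB).
Proof.
move=> hA hB i j.
have -> : (fun u => (A u *m B u) i j) = fun u => \sum_k A u i k * B u k j.
  by apply/funext => u; rewrite mxE.
by rewrite !mxE -big_split /=; apply: der_sum => k _; exact: derM.
Qed.

Lemma mxderD m n (A B : R -> 'M[R]_(m, n)) t dA dB :
  mxder A t dA -> mxder B t dB -> mxder (fun u => A u + B u) t (dA + dB).
Proof.
move=> hA hB i j; rewrite mxE.
have -> : (fun u => (A u + B u) i j) = fun u => A u i j + B u i j.
  by apply/funext => u; rewrite mxE.
exact: derD.
Qed.

Lemma mxderZ m n (A : R -> 'M[R]_(m, n)) c t dA :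
  mxder A t dA -> mxder (fun u => c *: A u) t (c *: dA).
Proof.
move=> hA i j; rewrite mxE.
have -> : (fun u => (c *: A u) i j) = fun u => c * A u i j.
  by apply/funext => u; rewrite mxE.
exact: derZ.
Qed.

Lemma mxderB m n (A B : R -> 'M[R]_(m, n)) t dA dB :
  mxder A t dA -> mxder B t dB -> mxder (fun u => A u - B u) t (dA - dB).
Proof.
move=> hA hB i j; rewrite 2!mxE.
have -> : (fun u => (A u - B u) i j) = fun u => A u i j - B u i j.
  by apply/funext => u; rewrite 2!mxE.
exact: derB.
Qed.

Lemma der_dot n (u v : R -> 'cV[R]_n) t du dv : mxder u t du -> mxder v t dv ->
  is_derive t 1 (fun s => dot (u s) (v s)) (dot du (v t) + dot (u t) dv).
Proof.
move=> hu hv; rewrite /dot -big_split /=; apply: der_sum => k _.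
exact: derM.
Qed.

Lemma der_dot_sqr n (u : R -> 'cV[R]_n) t du : mxder u t du ->
  is_derive t 1 (fun s => dot (u s) (u s)) (2 * dot (u t) du).
Proof. by move=> hu; refine (der_eq (der_dot hu hu) _); rewrite (dotC du); ring. Qed.

(** Chain rule for a matrix field along a curve. *)
Lemma mxder_field n m p (M : 'cV[R]_n -> 'M[R]_(m, p)) (q : R -> 'cV[R]_n) t dq :
  is_derive t (1 : R) q dq -> differentiable M (q t) ->
  mxder (fun u => M (q u)) t ('d M (q t) dq).
Proof.
move=> [dqt qdq] dM; apply: is_derive_mxder.
have dqd : differentiable q t by apply/derivable1_diffP.
have dMq : differentiable (M \o q) t by exact: differentiable_comp.
apply: DeriveDef; first exact/derivable1_diffP.
by rewrite (deriveE _ dMq) diff_comp//= -(deriveE _ dqd) qdq.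
Qed.

End MatrixDerivatives.

(** * Gradient of a function of the distance *)

Section Slope.
Context {R : realType}.
Implicit Types (psi : R -> R) (d l : R).

(** [l] is the derivative of [psi] with respect to the squared distance at [d];
    it is one-sided when [d = 0]. *)
Definition slope psi d l : Prop :=
  (psi (Num.sqrt s) - psi d) / (s - d ^+ 2)
    @[s --> within [set s | 0 <= s] (d ^+ 2)^'] --> l.

(** Chain rule; the one-sided slope at [0] is enough since the inner function is
    nonnegative. *)
Lemma slope_der psi (sg : R -> R) d l t dsg : 0 <= d -> slope psi d l ->
  sg t = d ^+ 2 -> (forall u, 0 <= sg u) -> is_derive t 1 sg dsg ->
  is_derive t 1 (fun u => psi (Num.sqrt (sg u))) (l * dsg).
Proof.
move=> d0 sl sgt sg0 /[dup] /der_continuous csg /is_derive1_caratheodory[g [gE cg gt]].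
pose Q s := if s == d ^+ 2 then l else (psi (Num.sqrt s) - psi d) / (s - d ^+ 2).
apply/is_derive1_caratheodory; exists (fun u => Q (sg u) * g u); split.
- move=> z; rewrite /Q sgt; have [E|zd] := eqVneq (sg z) (d ^+ 2).
    rewrite E subrr -mulrA -gE E sgt subrr mulr0 //.
  by rewrite -mulrA -gE sgt sqrtr_sqr ger0_norm// divfK// subr_eq0.
- apply: continuousM; last exact: cg.
  suff : Q (sg u) @[u --> t] --> l by rewrite -[X in _ --> X -> _](_ : Q (sg t) = l) // /Q sgt eqxx.
  apply/cvgrPdist_lt => e e0.
  move/cvgrPdist_lt : sl => /(_ _ e0).
  rewrite /within /= => H.
  have {}H : \forall s \near sg t, s != d ^+ 2 -> 0 <= s ->
    `|l - (psi (Num.sqrt s) - psi d) / (s - d ^+ 2)| < e by rewrite sgt; exact: H.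
  suff hu : \forall u \near t, `|l - Q (sg u)| < e by exact: hu.
  have K : \forall u \near t, sg u != d ^+ 2 -> 0 <= sg u ->
    `|l - (psi (Num.sqrt (sg u)) - psi d) / (sg u - d ^+ 2)| < e := csg _ H.
  near=> u.
  have Ku : sg u != d ^+ 2 -> 0 <= sg u ->
    `|l - (psi (Num.sqrt (sg u)) - psi d) / (sg u - d ^+ 2)| < e by near: u.
  rewrite /Q.
  by case: eqVneq => [_|ud]; [rewrite subrr normr0 | exact: Ku].
- by rewrite /Q sgt eqxx gt.
Unshelve. all: by end_near. Qed.

Lemma grad_slope n psi (x y : 'cV[R]_n) l : slope psi (enorm (x - y)) l ->
  grad psi x y = (2 * l) *: (x - y).
Proof.
move=> sl; apply/colP => k; rewrite !mxE.
pose v := delta_mx k 0 : 'cV[R]_n.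
pose F (z : 'cV[R]_n) := psi (enorm (z - y)).
have h : is_derive (0 : R) (1 : R) (fun h : R => F (h *: v + x)) (l * (2 * (x k 0 - y k 0))).
  rewrite /F; under eq_fun do rewrite enormE.
  apply: (slope_der (enorm_ge0 _) sl) => [|u|].
  - by rewrite scale0r add0r sqr_enorm.
  - exact: dot_ge0.
  have dv : mxder (fun h : R => h *: v + x - y) 0 v.
    move=> i j; have -> : (fun h : R => (h *: v + x - y) i j) =
        fun h => h * v i j + (x i j - y i j).
      by apply/funext => h; rewrite !mxE addrA.
    refine (der_eq (derD (derM (der_id _) (der_cst _ _)) (der_cst _ _)) _).
    by ring.
  refine (der_eq (der_dot_sqr dv) _); rewrite scale0r add0r; congr (2 * _).
  rewrite /dot (bigD1 k)//= !mxE !eqxx mulr1 big1 ?addr0// => j jk.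
  by rewrite !mxE (negbTE jk) mulr0.
have [_ D] := h.
transitivity ('D_1 (fun h : R => F (h *: v + x)) 0); last by rewrite D; ring.
rewrite /derive; set f1 := (X in lim (X @ _)); set f2 := (X in _ = lim (X @ _)).
suff -> : f1 = f2 by [].
apply/funext => s; rewrite /f1 /f2 /= /F scale0r add0r addr0 [s%:A]mulr1.
by [].
Qed.

End Slope.


(** * The inter-proxy potential *)

Section Potential.
Context {R : realType} {n : nat} {psi : R -> R} {rhat B zeta vartheta : R}.
Context (hpsi : potential rhat psi).
Context (hc : grad_bound n psi B zeta vartheta).
Context (rhat_gt0 : 0 < rhat) (rhatB : rhat <= B).
Context (hzeta : 0 < zeta) (hvartheta : 0 < vartheta).
Implicit Types (x y z : 'cV[R]_n) (d : R).

Lemma potential_slope : exists lam : R -> R,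
  forall d, 0 <= d < rhat -> 0 < lam d /\ slope psi d (lam d).
Proof.
have /choice[lam lamP] : forall d, exists l : R,
    0 <= d < rhat -> 0 < l /\ slope psi d l.
  move=> d; case: (boolP (0 <= d < rhat)) => [/andP[d0 dr]|_]; last by exists 0.
  by have [l l0 sl] := pot_deriv hpsi d0 dr; exists l.
by exists lam.
Qed.

(** The potential with its argument clamped to [[0, rhat]], which is continuous
    on the whole line. *)
Definition clamped_potential d : R := psi (Num.max 0 (Num.min d rhat)).

Lemma clamped_potentialE d : 0 <= d <= rhat -> clamped_potential d = psi d.
Proof. by move=> /andP[d0 dr]; rewrite /clamped_potential min_l// max_r. Qed.

Lemma continuous_clamped_potential : continuous clamped_potential.
Proof.
move=> d; pose cl (u : R) := Num.max 0 (Num.min u rhat).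
have clI u : cl u \in `[0, rhat].
  rewrite in_itv/= /cl le_max lexx/= ge_max (ltW rhat_gt0)/= ge_min lexx orbT//.
have ccl : {for d, continuous cl}.
  apply: (@continuous_max _ _ (fun=> 0) (fun u => Num.min u rhat)).
    exact: cst_continuous.
  by apply: (@continuous_min _ _ id (fun=> rhat)) => //; exact: cst_continuous.
have /subspace_continuousP/(_ (cl d) (clI d)) cp := pot_cont hpsi.
apply/cvgrPdist_lt => e e0; move/cvgrPdist_lt : cp => /(_ _ e0) H.
have {}H : \forall s \near cl d, s \in `[0, rhat] -> `|psi (cl d) - psi s| < e by exact: H.
have K : \forall u \near d, cl u \in `[0, rhat] -> `|psi (cl d) - psi (cl u)| < e := ccl _ H.
by near=> u; have : cl u \in `[0, rhat] -> `|psi (cl d) - psi (cl u)| < e; [near: u|exact].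
Unshelve. all: by end_near. Qed.

Section Slopes.
Context (lam : R -> R).
Context (lamP : forall d, 0 <= d < rhat -> 0 < lam d /\ slope psi d (lam d)).

Lemma grad_lam x y : enorm (x - y) < rhat ->
  grad psi x y = (2 * lam (enorm (x - y))) *: (x - y).
Proof.
by move=> xy; apply: grad_slope; apply: (lamP _).2; rewrite enorm_ge0.
Qed.

(** The gradient is bounded, since it is Lipschitz and vanishes on the diagonal. *)
Lemma grad_bounded x y k : (forall k, `|x k 0 - y k 0| <= B) ->
  `|grad psi x y k 0| <= (zeta + vartheta) * B.
Proof.
move=> xyB; have B0 : 0 <= B by apply: le_trans rhatB; exact: ltW.
have gxx : grad psi x x = 0 by rewrite grad_lam subrr ?scaler0 ?enorm0.
have xxB j : `|x j 0 - x j 0| <= B by rewrite subrr normr0.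
have := hc xyB xxB k; rewrite gxx [(0 : 'cV_n) k 0]mxE subr0 => /le_trans; apply.
rewrite mulrDl; apply: lerD; apply: ler_wpM2l; rewrite ?(ltW hzeta) ?(ltW hvartheta)//.
  by rewrite distrC.
by apply: norm_le => // j; rewrite !mxE distrC.
Qed.

(** Derivative of the potential with respect to the distance. *)
Definition rho d : R := 2 * lam d * d.

Lemma rho_lipschitz (k : 'I_n) d d' : 0 <= d < rhat -> 0 <= d' < rhat ->
  `|rho d - rho d'| <= (zeta + vartheta) * `|d - d'|.
Proof.
(* [rho] is the gradient along a line, so the gradient bound makes it Lipschitz. *)
move=> hd hd'; pose v c : 'cV[R]_n := - c *: delta_mx k 0.
have ve c j : v c j 0 = - c * (j == k)%:R by rewrite !mxE eqxx andbT.
have en c : 0 <= c -> enorm (0 - v c) = c.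
  move=> c0; rewrite sub0r /v scaleNr opprK enormZ ger0_norm// enormE /dot.
  rewrite (bigD1 k)//= big1 ?addr0; first by rewrite !mxE !eqxx mulr1 sqrtr1 mulr1.
  by move=> j jk; rewrite !mxE (negbTE jk) mulr0.
have rhoE c : 0 <= c < rhat -> rho c = grad psi 0 (v c) k 0.
  move=> /andP[c0 cr]; rewrite grad_lam en// !mxE !eqxx /rho /=; ring.
have vB c : 0 <= c < rhat -> forall j, `|(0 : 'cV[R]_n) j 0 - v c j 0| <= B.
  move=> /andP[c0 cr] j; have := coord_enorm (0 - v c) j.
  rewrite en// !mxE => /le_trans; apply; exact: le_trans (ltW cr) rhatB.
rewrite !rhoE//; apply: le_trans (hc (vB _ hd) (vB _ hd') k) _.
have vv j : `|v d j 0 - v d' j 0| <= `|d - d'|.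
  rewrite !ve -mulrBl normrM -opprD normrN -[leRHS]mulr1.
  by rewrite ler_wpM2l//; case: (j == k); rewrite ?normr1 ?normr0.
rewrite mulrDl; apply: lerD; apply: ler_wpM2l; rewrite ?(ltW hzeta) ?(ltW hvartheta)//.
by apply: norm_le => // j; have := vv j; rewrite !mxE.
Qed.

Lemma rho_le (k : 'I_n) d : 0 <= d < rhat -> rho d <= (zeta + vartheta) * B.
Proof.
move=> hd; have := rho_lipschitz k hd (_ : 0 <= 0 < rhat).
rewrite lexx rhat_gt0 => /(_ isT); rewrite /rho mulr0 !subr0 -/(rho d) => h.
case/andP: hd => d0 dr.
apply: (le_trans (ler_norm _)); apply: (le_trans h); rewrite ger0_norm//.
by rewrite ler_wpM2l ?addr_ge0 ?ltW// (lt_le_trans dr).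
Qed.

Lemma potential_der d : 0 < d < rhat -> is_derive d 1 psi (rho d).
Proof.
move=> /andP[d0 dr]; apply: (@der_near _ (fun u => psi (Num.sqrt (u * u)))).
  near=> u; rewrite -expr2 sqrtr_sqr ger0_norm// ltW//; near: u; exact: lt_nbhsr.
have sl : slope psi d (lam d) by apply: (lamP _).2; rewrite (ltW d0).
have der2 : is_derive d 1 (fun u : R => u * u) (1 * d + d * 1).
  exact: (derM (der_id _) (der_id _)).
refine (der_eq (slope_der (ltW d0) sl _ _ der2) _).
- by rewrite expr2.
- by move=> u; rewrite -expr2 sqr_ge0.
- by rewrite /rho; ring.
Unshelve. all: by end_near. Qed.

Lemma potential_lipschitz (k : 'I_n) d d' : 0 <= d -> d <= d' -> d' <= rhat ->
  psi d' - psi d <= (zeta + vartheta) * B * (d' - d).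
Proof.
move=> d0 dd' d'r; apply: der_le => //.
  apply: continuous_subspaceW (pot_cont hpsi) => u /=.
  by rewrite !in_itv/= => /andP[du ud']; rewrite (le_trans d0)// (le_trans ud').
move=> u /andP[du ud']; exists (rho u).
  by apply: potential_der; rewrite (le_lt_trans d0)// (lt_le_trans ud').
by apply: rho_le => //; rewrite (le_trans d0 (ltW du)) (lt_le_trans ud').
Qed.

Lemma rho_lower (k : 'I_n) d d' : 0 < d -> d <= d' -> d' < rhat ->
  exists2 c, 0 < c & forall u, d <= u <= d' -> c <= rho u.
Proof.
move=> d0 dd' d'r.
have inI u : u \in `[d, d'] -> 0 <= u < rhat.
  rewrite in_itv/= => /andP[du ud'].
  by rewrite (le_trans (ltW d0) du) (le_lt_trans ud').
have crho : {within `[d, d'], continuous rho}.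
  apply/subspace_continuousP => u uI; apply/cvgrPdist_le => e e0.
  have zv : 0 < zeta + vartheta by rewrite addr_gt0.
  suff near_u : \forall w \near u, w \in `[d, d'] -> `|rho u - rho w| <= e.
    exact: near_u.
  near=> w => wI; apply: (le_trans (rho_lipschitz k (inI _ uI) (inI _ wI))).
  rewrite mulrC -ler_pdivlMr//; near: w.
  by exists (e / (zeta + vartheta)); [rewrite /= divr_gt0 | move=> w /ltW].
have [c cI cmin] := EVT_min dd' crho.
exists (rho c); last by move=> u uI; apply: cmin; rewrite in_itv.
have /andP[c0 cr] := inI _ cI.
rewrite /rho !mulr_gt0//; first by apply: (lamP _).1; rewrite c0.
by move: cI; rewrite in_itv/= => /andP[/(lt_le_trans d0)].
Unshelve. all: by end_near. Qed.

Lemma clamped_potential_der (v : R -> 'cV[R]_n) t dv : mxder v t dv ->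
  enorm (v t) < rhat -> is_derive t 1 (fun u => clamped_potential (enorm (v u)))
    (2 * lam (enorm (v t)) * dot (v t) dv).
Proof.
move=> hv vr; have ds := der_dot_sqr hv.
have vt : 0 <= enorm (v t) < rhat by rewrite enorm_ge0.
have cv : {for t, continuous (fun u => enorm (v u))}.
  have -> : (fun u => enorm (v u)) = fun u => Num.sqrt (dot (v u) (v u)).
    by apply/funext => u; exact: enormE.
  apply: (continuous_comp (f := fun u => dot (v u) (v u)) (g := Num.sqrt)).
    exact: der_continuous ds.
  exact: sqrt_continuous.
apply: (@der_near _ (fun u => psi (Num.sqrt (dot (v u) (v u))))).
  near=> u; rewrite -enormE clamped_potentialE// enorm_ge0/= ltW//.
  near: u; exact: (cvgr_lt _ cv).
refine (der_eq (slope_der (enorm_ge0 _) (lamP vt).2 _ _ ds) _).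
- by rewrite sqr_enorm.
- by move=> u; exact: dot_ge0.
- ring.
Unshelve. all: by end_near. Qed.

End Slopes.

Section Gap.
Context {N : nat} {E : rel 'I_N} {Psimax : R}.
Context (hmax : forall y : 'I_N -> 'cV[R]_n,
  (forall i j, E i j -> enorm (y i - y j) <= rhat) ->
  (exists i j, E i j /\ enorm (y i - y j) = rhat) -> Psimax <= Psi E psi y).

(** A configuration of energy at most [c < Psimax] keeps its edges uniformly
    shorter than [rhat]: otherwise a slight dilation would make an edge of length
    exactly [rhat] at almost no cost in energy. *)
Lemma edge_gap (k : 'I_n) c : c < Psimax ->
  exists2 h, 0 < h & forall y : 'I_N -> 'cV[R]_n,
    (forall i j, E i j -> enorm (y i - y j) <= rhat) -> Psi E psi y <= c ->
    forall i j, E i j -> enorm (y i - y j) <= rhat - h.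
Proof.
move=> cP; have [lam lamP] := potential_slope.
(* [psi] is Lipschitz with constant [C]: dilating all the edges by at most [h] raises
   the energy by at most [N^2 C h / 2], which is less than [Psimax - c]. *)
pose C := (zeta + vartheta) * B.
have C0 : 0 < C by rewrite mulr_gt0 ?addr_gt0// (lt_le_trans rhat_gt0).
pose D := N%:R ^+ 2 * C + 1.
have NC : 0 <= N%:R ^+ 2 * C by rewrite mulr_ge0 ?sqr_ge0 ?ltW.
have D0 : 0 < D by rewrite ltr_wpDl.
pose h := Num.min (rhat / 2) ((Psimax - c) / D).
have h0 : 0 < h by rewrite lt_min !divr_gt0 ?subr_gt0.
have hr : h <= rhat / 2 by rewrite ge_min lexx.
have hD : h * D <= Psimax - c by rewrite -ler_pdivlMr// ge_min lexx orbT.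
exists h => // y yr yc i j Eij; rewrite leNgt; apply/negP => ij.
pose len (e : 'I_N * 'I_N) := enorm (y e.1 - y e.2).
have [[i0 j0] /= E0 lmax] := @arg_maxP _ R _ (i, j) (fun e => E e.1 e.2) len Eij.
set d0 := len (i0, j0) in lmax.
have d0h : rhat - h < d0 by exact: lt_le_trans ij (lmax (i, j) Eij).
have d0r : d0 <= rhat by exact: yr.
have d0p : 0 < d0 by move: d0h hr rhat_gt0; lra.
pose l := rhat / d0.
have l1 : 1 <= l by rewrite ler_pdivlMr// mul1r.
have ld0 : l * d0 = rhat by rewrite divfK// gt_eqF.
have lenZ p r : enorm (l *: y p - l *: y r) = l * len (p, r).
  by rewrite -scalerBr enormZ ger0_norm// (le_trans ler01).
have lr p r : E p r -> l * len (p, r) <= rhat.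
  by move=> Epr; rewrite -ld0 ler_wpM2l ?(le_trans ler01)//; exact: (lmax (p, r)).
have : Psimax <= Psi E psi (fun p => l *: y p).
  apply: hmax; first by move=> p r Epr; rewrite lenZ lr.
  by exists i0, j0; split; rewrite // lenZ.
have : Psi E psi (fun p => l *: y p) - Psi E psi y <= 2^-1 * (N%:R ^+ 2 * C * h).
  rewrite /Psi -mulrBr ler_wpM2l// -sumrB.
  have -> : N%:R ^+ 2 * C * h = \sum_(p < N) \sum_(r < N) (C * h).
    by rewrite !sumr_const !card_ord -mulrnA -[RHS]mulr_natl natrM expr2 !mulrA.
  apply: ler_sum => p _; rewrite -sumrB big_mkcond/=; apply: ler_sum => r _.
  case: ifPn => [Epr|_]; last by rewrite mulr_ge0 ?ltW.
  rewrite lenZ; have e0 : 0 <= len (p, r) := enorm_ge0 _.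
  apply: (le_trans (potential_lipschitz lamP k e0 _ (lr _ _ Epr))).
    by rewrite ler_peMl.
  rewrite ler_wpM2l ?(ltW C0)//.
  have : (l - 1) * len (p, r) <= (l - 1) * d0.
    by rewrite ler_wpM2l ?subr_ge0//; exact: (lmax (p, r)).
  by rewrite !mulrBl ld0 !mul1r; lra.
have : 0 <= h * (N%:R ^+ 2 * C) by rewrite mulr_ge0// ltW.
rewrite /D in hD; lra.
Qed.

End Gap.
End Potential.


(** * The agent-proxy potential *)

Section AgentProxyPotential.
Context {R : realType} {n : nat}.
Implicit Types (b y : 'cV[R]_n) (p c : R).

Let satp (b p s : R) : R := sat b (p * s).

Let continuous_satp (b p : R) : continuous (satp b p).
Proof.
move=> s; apply: (continuous_comp (f := fun s => p * s) (g := sat b)).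
  by apply: continuousM => //; exact: cst_continuous.
exact: continuous_sat.
Qed.

Lemma integral_sat_shrink (b p c y : R) : 0 <= b -> 0 < p -> 0 <= c <= 1 ->
  Defs.integral0 (satp b p) (c * y) <= Defs.integral0 (satp b p) y.
Proof.
move=> b0 p0 /andP[c0 c1].
have dF s := primitive_der s (@continuous_satp b p).
have cF u v : {within `[u, v], continuous (Defs.integral0 (satp b p))}.
  by apply: continuous_subspaceT => s; exact: der_continuous (dF s).
have [y0|/ltW y0] := leP 0 y.
  rewrite -subr_ge0 -[leLHS](mul0r (y - c * y)); apply: der_ge => //.
    by rewrite ler_piMl.
  move=> s /andP[ys _]; exists (satp b p s) => //; apply: sat_ge0 => //.
  by rewrite mulr_ge0 ?(ltW p0)// (le_trans _ (ltW ys))// mulr_ge0.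
rewrite -subr_le0 -[leRHS](mul0r (c * y - y)); apply: der_le => //.
  by rewrite ler_niMl.
move=> s /andP[_ ys]; exists (satp b p s) => //; apply: sat_le0 => //.
by rewrite mulr_ge0_le0 ?(ltW p0)// (le_trans (ltW ys))// mulr_ge0_le0.
Qed.

Lemma phi_shrink b p c y : (forall k, 0 <= b k 0) -> 0 < p -> 0 <= c <= 1 ->
  phi b p (c *: y) <= phi b p y.
Proof.
move=> b0 p0 c01; rewrite /phi; apply: ler_sum => k _.
by rewrite mxE; exact: integral_sat_shrink.
Qed.

Lemma phi0 b p : phi b p 0 = 0.
Proof. by rewrite /phi big1// => k _; rewrite mxE integral00. Qed.

Lemma phi_ge0 b p y : (forall k, 0 <= b k 0) -> 0 < p -> 0 <= phi b p y.
Proof.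
move=> b0 p0; rewrite -(phi0 b p) -(scale0r y); apply: phi_shrink => //.
by rewrite lexx ler01.
Qed.

Lemma phi_der b p (y : R -> 'cV[R]_n) t dy : mxder y t dy ->
  is_derive t 1 (fun u => phi b p (y u)) (dot (satv b (p *: y t)) dy).
Proof.
move=> hy; rewrite /phi /dot; apply: der_sum => k _.
have dF := primitive_der (y t k 0) (@continuous_satp (b k 0) p).
by refine (der_eq (der_comp dF (hy k 0)) _); rewrite !mxE.
Qed.

(** Below the level [phi_star] the agent is within [eps / 3] of its proxy: [phi]
    is monotone along rays and at least [phi_star] on the sphere. *)
Lemma phi_star_lt (N : nat) (b : 'I_N -> 'cV[R]_n) (p : 'I_N -> R) (eps : R) i y :
  0 < eps -> (forall i k, 0 <= b i k 0) -> (forall i, 0 < p i) ->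
  phi (b i) (p i) y < phi_star b p eps -> enorm y < eps / 3.
Proof.
move=> e0 b0 p0; apply: contraTT; rewrite -!leNgt => ye.
have e3 : 0 < eps / 3 by rewrite divr_gt0.
have y0 : 0 < enorm y by exact: lt_le_trans ye.
have lb j : lbound
    [set phi (b j) (p j) y | y in [set y : 'cV[R]_n | enorm y = eps / 3]] 0.
  by move=> _ [z _ <-]; exact: phi_ge0.
(* [c y] is the radial projection of [y] to the sphere. *)
pose c := eps / 3 / enorm y.
have c01 : 0 <= c <= 1 by rewrite /c divr_ge0 ?(ltW e3) ?(ltW y0)//= ler_pdivrMr ?mul1r.
have cy : enorm (c *: y) = eps / 3.
  by rewrite enormZ ger0_norm ?divfK ?gt_eqF//; case/andP: c01.
apply: le_trans (phi_shrink y (b0 i) (p0 i) c01).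
apply: (@le_trans _ _ (phi_min (b i) (p i) eps)).
  apply: ge_inf; last by exists i.
  exists 0 => _ [j _ <-]; rewrite /phi_min; apply: lb_le_inf; last exact: lb.
  by exists (phi (b j) (p j) (c *: y)), (c *: y).
by apply: ge_inf; [exists 0; exact: lb | exists (c *: y)].
Qed.

End AgentProxyPotential.

(** * Energy balance of one agent *)

Section AgentEnergy.
Context {R : realType} {n m : nat} (A : el_agent R n m) (alpha : R).
Context (hA : el_properties A alpha).

Let M := inertia A.
Let C := coriolis A.
Let g := gravity A.

Lemma inertia_energy_ge0 x (s : 'cV[R]_n) : 0 <= dot s (M x *m s).
Proof.
have [[_ [l1 [l2 [l10 _ h]]]] _ _ _] := hA; case/andP: (h x s) => + _.
by rewrite -mulmxA dotE; apply: le_trans; rewrite mulr_ge0 ?sqr_ge0// ltW.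
Qed.

Lemma inertia_energy_bound : exists2 l, 0 < l &
  forall x (s : 'cV[R]_n), l * enorm s ^+ 2 <= dot s (M x *m s).
Proof.
have [[_ [l1 [l2 [l10 _ h]]]] _ _ _] := hA; exists l1 => // x s.
by case/andP: (h x s) => + _; rewrite -mulmxA dotE.
Qed.

Lemma dot_mulmx p r (X : 'M[R]_(p, r)) u v : dot u (X *m v) = dot (X^T *m u) v.
Proof. by rewrite -!dotE trmx_mul trmxK mulmxA. Qed.

Lemma dot_skew (S : 'M[R]_n) (u : 'cV[R]_n) : S^T = - S -> dot u (S *m u) = 0.
Proof.
move=> sk; have : dot u (S *m u) = - dot u (S *m u).
  by rewrite {1}dot_mulmx sk mulNmx dotNl dotC.
by move/eqP; rewrite -subr_eq0 opprK -mulr2n mulrn_eq0 => /eqP.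
Qed.

(** Power balance of the sliding variable [s = v + alpha e]: skew-symmetry
    cancels the Coriolis power, and linearity in the parameters leaves the
    estimation error. *)
Lemma sliding_energy_der (q v e : R -> 'cV[R]_n) t ddq de th w :
  let s u := v u + alpha *: e u in
  let P := regressor A (q t) (v t) (e t) de in
  is_derive t (1 : R) q (v t) -> is_derive t (1 : R) v ddq -> mxder e t de ->
  M (q t) *m ddq + C (q t) (v t) *m v t + g (q t) = P *m th - w ->
  is_derive t 1 (fun u => 2^-1 * dot (s u) (M (q u) *m s u))
    (- dot (s t) (P *m (param A - th)) - dot (s t) w).
Proof.
move=> s P dq dv hde dyn.
have [[Msym _] p2 _ p4] := hA.
have [dM skew] := p2 (q t) (v t).
pose dMt := 'd M (q t) (v t); pose ds := ddq + alpha *: de.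
have hs : mxder s t ds.
  by apply: mxderD; [exact: is_derive_mxder | exact: mxderZ].
have hM : mxder (fun u => M (q u)) t dMt by exact: mxder_field.
refine (der_eq (derZ 2^-1 (der_dot hs (mxderM hM hs))) _).
have dMs : dot (s t) (dMt *m s t) = 2 * dot (s t) (C (q t) (v t) *m s t).
  have -> : dMt = (dMt - 2 *: C (q t) (v t)) + 2 *: C (q t) (v t) by rewrite subrK.
  by rewrite mulmxDl dotDr (dot_skew _ skew) add0r -scalemxAl dotZr.
have Mds : dot ds (M (q t) *m s t) = dot (s t) (M (q t) *m ds).
  by rewrite dot_mulmx Msym dotC.
have key : M (q t) *m ds + C (q t) (v t) *m s t = - (P *m (param A - th)) - w.
  have -> : - (P *m (param A - th)) = P *m th - P *m param A.
    by rewrite mulmxBr opprB.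
  rewrite addrAC -dyn /P p4 /ds /s !mulmxDr -!scalemxAr.
  apply/colP => k; rewrite !mxE.
  ring.
by rewrite Mds dotDr dMs -dotNr -dotBr -key dotDr; field.
Qed.

Lemma adaptation_energy_der (th : R -> 'cV[R]_m) t dth be : 0 < be ->
  mxder th t dth ->
  is_derive t 1 (fun u => (2 * be)^-1 * dot (param A - th u) (param A - th u))
    (- (be^-1 * dot (param A - th t) dth)).
Proof.
move=> be0 hth; have hd : mxder (fun u => param A - th u) t (0 - dth).
  by apply: mxderB => // i j; rewrite mxE; exact: der_cst.
refine (der_eq (derZ _ (der_dot_sqr hd)) _).
by rewrite sub0r dotNr; field; rewrite gt_eqF.
Qed.

End AgentEnergy.

Section Dissipation.
Context {R : realType} {n : nat}.

Lemma sat_descent (b s e : 'cV[R]_n) mu : 0 < mu ->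
  0 <= dot s (satv b (mu *: s + e) - satv b e).
Proof.
move=> mu0; apply: sumr_ge0 => k _; rewrite !mxE.
have [s0|/ltW s0] := leP 0 (s k 0).
  by rewrite mulr_ge0// subr_ge0 sat_le// lerDr mulr_ge0// ltW.
by rewrite mulr_le0// subr_le0 sat_le// gerDr mulr_ge0_le0// ltW.
Qed.

Lemma projv_descent m (lo up th th0 w : 'cV[R]_m) delta : 0 < delta ->
  (forall k, lo k 0 + delta <= th0 k 0 <= up k 0 - delta) ->
  dot (th0 - th) (w - Defs.projv lo up delta th w) <= 0.
Proof.
move=> d0 h; rewrite /dot -oppr_ge0 -sumrN; apply: sumr_ge0 => k _.
by rewrite oppr_ge0 !mxE; exact: proj_descent.
Qed.

Lemma satv_mul_ge0 (b e : 'cV[R]_n) : (forall k, 0 <= b k 0) ->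
  0 <= dot (satv b e) e.
Proof. by move=> b0; apply: sumr_ge0 => k _; rewrite mxE sat_mul_ge0. Qed.

Lemma satv_mul_coord (b e : 'cV[R]_n) k : (forall k, 0 <= b k 0) ->
  sat (b k 0) (e k 0) * e k 0 <= dot (satv b e) e.
Proof.
move=> b0; rewrite /dot (bigD1 k)//= mxE lerDl.
by apply: sumr_ge0 => l _; rewrite mxE sat_mul_ge0.
Qed.

End Dissipation.


(** * Delayed signals *)

Section DelayedSignals.
Context {R : realType} {n : nat}.
Context (x v : R -> 'cV[R]_n).
Context (cv : forall k, continuous (fun u => v u k 0)).
Context (cx : forall k, continuous (fun u => x u k 0)).
Context (v_past : forall u : R, u <= 0 -> v u = 0).
Context (x_past : forall u : R, u <= 0 -> x u = x 0).
Context (dx : forall u : R, 0 < u -> mxder x u (v u)).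

(** Squared speed, its primitive and the primitive of the latter, both null
    at [0]. *)
Definition speed2 (u : R) : R := dot (v u) (v u).
Definition travel (u : R) : R := Defs.integral0 speed2 u.
Definition travel2 (u : R) : R := Defs.integral0 travel u.

(** Lyapunov-Krasovskii functional for delays at most [T]: [T] times the integral,
    over [w] in [u - T, u], of the integral of the squared speed from [w] to [u].
    The inner double integral is written with the iterated primitives. *)
Definition krasovskii (T u : R) : R :=
  T * (T * travel u - (travel2 u - travel2 (u - T))).

Lemma continuous_speed2 : continuous speed2.
Proof.
move=> u; rewrite /speed2 /dot.
move: u; apply: continuous_bigsum => k _ u.
by apply: continuousM; exact: cv.
Qed.

Lemma travel_der (u : R) : is_derive u 1 travel (speed2 u).
Proof. exact: primitive_der continuous_speed2. Qed.

Lemma continuous_travel : continuous travel.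
Proof. by move=> u; exact: der_continuous (travel_der u). Qed.

Lemma travel2_der (u : R) : is_derive u 1 travel2 (travel u).
Proof. exact: primitive_der continuous_travel. Qed.

Lemma travel_le (s t : R) : s <= t -> travel s <= travel t.
Proof.
move=> st; rewrite -subr_ge0 -[leLHS](mul0r (t - s)); apply: der_ge => //.
  by apply: continuous_subspaceT; exact: continuous_travel.
by move=> u _; exists (speed2 u); [exact: travel_der | exact: dot_ge0].
Qed.

Lemma krasovskii_der (T t : R) : is_derive t 1 (krasovskii T)
  (T ^+ 2 * speed2 t - T * (travel t - travel (t - T))).
Proof.
have d2 : is_derive t 1 (fun u => travel2 (u - T)) (travel (t - T) * (1 - 0)).
  exact: (der_comp (g := fun u => u - T) (travel2_der (t - T)) (derB (der_id t) (der_cst T t))).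
refine (der_eq (derZ T (derB (derZ T (travel_der t)) (derB (travel2_der t) d2))) _).
ring.
Qed.

Lemma continuous_krasovskii (T : R) : continuous (krasovskii T).
Proof. by move=> t; exact: der_continuous (krasovskii_der T t). Qed.

Lemma krasovskii_ge0 (T t : R) : 0 <= T -> 0 <= krasovskii T t.
Proof.
move=> T0; rewrite /krasovskii mulr_ge0// subr_ge0.
have tT : t - T <= t by rewrite gerBl.
have : travel2 t - travel2 (t - T) <= travel t * (t - (t - T)).
  apply: der_le => //.
    apply: continuous_subspaceT => u; exact: der_continuous (travel2_der u).
  move=> u /andP[_ ut]; exists (travel u); first exact: travel2_der.
  exact: travel_le (ltW ut).
by rewrite subKr mulrC.
Qed.

Lemma krasovskii0 (T : R) : 0 <= T -> krasovskii T 0 = 0.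
Proof.
move=> T0.
have h (u : R) : u <= 0 -> speed2 u = 0.
  by move=> /v_past vu; rewrite /speed2 vu -(scale0r (0 : 'cV[R]_n)) dotZl mul0r.
have null (f : R -> R) (df : R -> R) : f 0 = 0 ->
    (forall u : R, is_derive u 1 f (df u)) -> (forall u, u <= 0 -> df u = 0) ->
    forall u, u <= 0 -> f u = 0.
  move=> f0 fd df0 u u0.
  have cf : {within `[u, 0], continuous f}.
    by apply: continuous_subspaceT => w; exact: der_continuous (fd w).
  have D (w : R) : u < w < 0 -> is_derive w 1 f 0.
    by move=> /andP[_ /ltW w0]; rewrite -(df0 _ w0).
  have : f 0 - f u <= 0 * (0 - u).
    by apply: der_le => // w /D dw; exists 0.
  have : 0 * (0 - u) <= f 0 - f u.
    by apply: der_ge => // w /D dw; exists 0.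
  rewrite f0 mul0r; lra.
have t0 := null travel speed2 (integral00 _) travel_der h.
have t20 := null travel2 travel (integral00 _) travel2_der t0.
by rewrite /krasovskii t0// !t20 ?sub0r ?oppr_le0//; ring.
Qed.

(** Cauchy-Schwarz in time: the displacement over a delay is controlled by the
    integral of the squared speed over any longer delay. *)
Lemma displacement_le (T Tb t : R) : 0 <= t -> 0 <= T <= Tb ->
  dot (x t - x (t - T)) (x t - x (t - T)) <= Tb * (travel t - travel (t - Tb)).
Proof.
move=> t0 /andP[T0 TTb].
pose s0 := Num.max 0 (t - T).
have s00 : 0 <= s0 by rewrite le_max lexx.
have s0t : s0 <= t by rewrite ge_max t0 gerBl.
have s0T : t - s0 <= T by rewrite lerBlDl -lerBlDr le_max lexx orbT.
have -> : x (t - T) = x s0.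
  by rewrite /s0; case: (lerP 0 (t - T)) => // /ltW /x_past.
have Hs : travel (t - Tb) <= travel s0.
  apply: travel_le; apply: (@le_trans _ _ (t - T)); first by rewrite lerB.
  by rewrite le_max lexx orbT.
have Hst := travel_le s0t.
apply: (@le_trans _ _ ((t - s0) * (travel t - travel s0))); last first.
  apply: ler_pM; rewrite ?subr_ge0//; first exact: le_trans TTb.
  by rewrite lerB.
move: s0t; rewrite le_eqVlt => /predU1P[->|s0t].
  by rewrite !subrr mul0r -(scale0r (0 : 'cV[R]_n)) dotZl mul0r.
set D := x t - x s0; set tau := t - s0.
have tau0 : 0 < tau by rewrite subr_gt0.
pose c := tau^-1 *: D.
(* Integrate 2 <c, v> - |c|^2 <= |v|^2, where c is the mean velocity. *)
pose F u := 2 * dot c (x u) - dot c c * u - travel u.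
have cF : {within `[s0, t], continuous F}.
  have c1 : continuous (fun u => dot c (x u)).
    apply: continuous_bigsum => k _ u.
    by apply: continuousM; [exact: cst_continuous | exact: cx].
  apply: continuous_subspaceT => u; apply: cvgB; last exact: continuous_travel.
  apply: cvgB; apply: cvgM; [exact: cvg_cst | exact: c1 | exact: cvg_cst | exact: cvg_id].
have : F t - F s0 <= 0 * (t - s0).
  apply: der_le => //; first exact: ltW.
  move=> u /andP[s0u _]; have u0 : 0 < u by exact: le_lt_trans s0u.
  have hc : mxder (fun=> c) u 0.
    by move=> i j; rewrite [X in is_derive _ _ _ X]mxE; exact: der_cst.
  have dF := derB (derB (derZ 2 (der_dot hc (dx u0)))
    (derZ (dot c c) (der_id u))) (travel_der u).
  exists (- dot (c - v u) (c - v u)); last by rewrite oppr_le0 dot_ge0.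
  refine (der_eq dF _).
  rewrite -(scale0r (0 : 'cV[R]_n)) dotZl mul0r /speed2 !(dotBl, dotBr) (dotC (v u) c).
  by ring.
have Dc : D = tau *: c by rewrite /c scalerA divff ?scale1r ?gt_eqF.
have -> : F t - F s0 = 2 * dot c D - dot c c * tau - (travel t - travel s0).
  by rewrite /F /D dotBr /tau; ring.
rewrite mul0r Dc !(dotZl, dotZr) => h.
rewrite ler_pM2l//; lra.
Qed.

End DelayedSignals.

Section Young.
Context {R : realType} {n : nat}.
Implicit Types (u d g : 'cV[R]_n) (a zeta vartheta S : R).

Lemma young (a y z : R) : 0 < a -> y * z <= a / 2 * y ^+ 2 + z ^+ 2 / (2 * a).
Proof.
move=> a0; rewrite -subr_ge0.
have -> : a / 2 * y ^+ 2 + z ^+ 2 / (2 * a) - y * z = (a * y - z) ^+ 2 / (2 * a).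
  by field; rewrite gt_eqF.
by rewrite divr_ge0 ?sqr_ge0// mulr_ge0// ltW.
Qed.

(** Power of a perturbation [g] controlled by a displacement [d], after Young's
    inequality with weight [a]. *)
Lemma perturbation_power a zeta vartheta S u d g : 0 < a -> 0 < zeta -> 0 < vartheta ->
  (forall k, `|g k 0| <= zeta * `|d k 0| + vartheta * `|d|) -> dot d d <= S ->
  dot u g <= a * (zeta + vartheta) / 2 * dot u u
    + (zeta + n%:R * vartheta) / (2 * a) * S.
Proof.
move=> a0 z0 v0 gd dS.
have a20 : 0 <= (2 * a)^-1 by rewrite invr_ge0 mulr_ge0// ltW.
have S0 : 0 <= S by apply: le_trans dS; exact: dot_ge0.
have dn : `|d| ^+ 2 <= S.
  apply: norm_sq_le => // k; apply: le_trans dS.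
  exact: sqr_coord_le.
have step k : u k 0 * g k 0 <= a * (zeta + vartheta) / 2 * (u k 0 * u k 0)
    + zeta / (2 * a) * (d k 0 * d k 0) + vartheta / (2 * a) * S.
  apply: (@le_trans _ _ (`|u k 0| * (zeta * `|d k 0| + vartheta * `|d|))).
    apply: (le_trans (ler_norm _)); rewrite normrM.
    by rewrite ler_wpM2l.
  have y1 := young `|u k 0| `|d k 0| a0; have y2 := young `|u k 0| `|d| a0.
  rewrite !real_normK ?num_real// in y1 y2.
  have {}y1 := ler_wpM2l (ltW z0) y1; have {}y2 := ler_wpM2l (ltW v0) y2.
  have h : vartheta * (`|d| ^+ 2 / (2 * a)) <= vartheta * (S / (2 * a)).
    by rewrite ler_wpM2l ?(ltW v0)// ler_wpM2r.
  rewrite -!expr2; lra.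
rewrite {1}/dot; apply: (le_trans (ler_sum _ (fun k _ => step k))).
rewrite !big_split /= -!mulr_sumr sumr_const card_ord -[_ *+ n]mulr_natl.
have h : zeta / (2 * a) * dot d d <= zeta / (2 * a) * S.
  by rewrite ler_wpM2l// mulr_ge0// ltW.
rewrite -/(dot u u) -/(dot d d).
have -> : (zeta + n%:R * vartheta) / (2 * a) * S =
  zeta / (2 * a) * S + n%:R * (vartheta / (2 * a) * S) by ring.
lra.
Qed.

End Young.


(** * Continuity of signals *)

Section ContinuousMatrices.
Context {R : realType}.

Lemma continuous_coord m n (M : R -> 'M[R]_(m, n)) i j :
  continuous M -> continuous (fun u => M u i j).
Proof.
move=> cM u; apply: (continuous_comp (f := M) (g := fun X : 'M[R]_(m, n) => X i j)).
  exact: cM.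
exact: coord_continuous.
Qed.

Lemma continuous_mx m n (M : R -> 'M[R]_(m, n)) :
  (forall i j, continuous (fun u => M u i j)) -> continuous M.
Proof.
move=> cM u; apply/cvgrPdist_le => e e0; near=> w.
rewrite [leLHS]/Num.norm/= mx_normrE (bigmax_le _ (ltW e0))//= => i _.
rewrite !mxE; move: i; near: w; apply: filter_forall => i.
by have /cvgrPdist_le/(_ _ e0) := cM i.1 i.2 u.
Unshelve. all: by end_near. Qed.

Lemma continuous_mulmx m n p (A : R -> 'M[R]_(m, n)) (B : R -> 'M[R]_(n, p)) :
  continuous A -> continuous B -> continuous (fun u => A u *m B u).
Proof.
move=> cA cB; apply: continuous_mx => i j.
have -> : (fun u => (A u *m B u) i j) = fun u => \sum_k A u i k * B u k j.
  by apply/funext => u; rewrite mxE.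
by apply: continuous_bigsum => k _ u; apply: continuousM; exact: continuous_coord.
Qed.

Lemma continuous_dot n (u v : R -> 'cV[R]_n) :
  continuous u -> continuous v -> continuous (fun s => dot (u s) (v s)).
Proof.
move=> cu cv; apply: continuous_bigsum => k _ s.
by apply: continuousM; exact: continuous_coord.
Qed.

Lemma continuous_enorm n (u : R -> 'cV[R]_n) :
  continuous u -> continuous (fun s => enorm (u s)).
Proof.
move=> cu; have -> : (fun s => enorm (u s)) = fun s => Num.sqrt (dot (u s) (u s)).
  by apply/funext => s; exact: enormE.
move=> s; apply: (continuous_comp (f := fun s => dot (u s) (u s)) (g := Num.sqrt)).
  exact: continuous_dot.
exact: sqrt_continuous.
Qed.

Lemma continuous_phi n b p (y : R -> 'cV[R]_n) :
  continuous y -> continuous (fun u => phi b p (y u)).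
Proof.
move=> cy; apply: continuous_bigsum => k _ u.
apply: (continuous_comp (f := fun u => y u k 0)
  (g := Defs.integral0 (fun s => sat (b k 0) (p * s)))).
  exact: continuous_coord.
apply: der_continuous; apply: primitive_der => s.
apply: (continuous_comp (f := fun s => p * s) (g := sat (b k 0))).
  by apply: continuousM => //; exact: cst_continuous.
exact: continuous_sat.
Qed.

Lemma continuous_le_left (f : R -> R) (c t : R) : continuous f -> 0 < t ->
  (forall s, 0 <= s < t -> f s <= c) -> f t <= c.
Proof.
move=> cf t0 fc; rewrite leNgt; apply/negP => cft.
have : \forall s \near t, c < f s by exact: (cvgr_gt _ (cf t)).
move=> [e /= e0 he].
pose s := Num.max 0 (t - e / 2).
have st : s < t by rewrite gt_max t0/= ltrBlDr ltrDl divr_gt0.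
have := fc s; rewrite le_max lexx st/= => /(_ isT); rewrite leNgt => /negP; apply.
apply: he; rewrite /= gtr0_norm ?subr_gt0// ltrBlDr -ltrBlDl.
by rewrite lt_max [X in _ || X]ltrD2l ltrN2 gtr_pMr// invf_lt1 ?ltr1n ?orbT.
Qed.

Lemma bounded_der_lipschitz (f : R -> R) (D s t : R) : continuous f -> 0 <= s -> s <= t ->
  (forall u, s < u < t -> exists2 d, is_derive u 1 f d & `|d| <= D) ->
  `|f t - f s| <= D * (t - s).
Proof.
move=> cf s0 st fd; rewrite ler_norml -mulNr; apply/andP; split.
  apply: der_ge => //; first exact: continuous_subspaceT.
  by move=> u /fd[d du]; rewrite ler_norml => /andP[dD _]; exists d.
apply: der_le => //; first exact: continuous_subspaceT.
by move=> u /fd[d du]; rewrite ler_norml => /andP[_ dD]; exists d.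
Qed.

End ContinuousMatrices.


(** * Lyapunov analysis of the closed loop *)

Section LyapunovAnalysis.
Context {R : realType} {N n : nat} {m : 'I_N -> nat}.
Context {A : forall i : 'I_N, el_agent R n (m i)}.
Context {thlo thup : forall i : 'I_N, 'cV[R]_(m i)} {delta : R}.
Context {fbar eta : 'I_N -> 'cV[R]_n}.
Context {E : rel 'I_N} {T : 'I_N -> 'I_N -> R -> R} {Tbar : 'I_N -> 'I_N -> R}.
Context {r eps rhat Psimax : R} {psi : R -> R} {B zeta vartheta a : R}.
Context {upsilon : 'I_N -> R} {G : gains R N} {x : trajectory R n m}.
Context (hG : gains_pos G)
  (hA : forall i, el_properties (A i) (g_alpha G))
  (hdelta : 0 < delta)
  (htheta : forall i k,
     thlo i k 0 + delta <= param (A i) k 0 <= thup i k 0 - delta)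
  (hT : forall i j (t : R), E i j -> 0 <= t -> 0 <= T j i t <= Tbar j i)
  (hx : closed_loop A thlo thup delta fbar eta E T psi G x)
  (heps : 0 < eps)
  (hEsym : symmetric E)
  (hEconn : forall i j, connect E i j)
  (hE0 : forall i j, E i j -> enorm (q x i 0 - q x j 0) <= r - eps)
  (hrest : forall i, dq x i 0 = 0)
  (heta : forall i k, 0 <= eta i k 0 < fbar i k 0)
  (hPhi : forall i k (t : R), 0 <= t ->
     `|(Phi A G x i t *m thh x i t) k 0| <= eta i k 0)
  (hrhat : rhat = r - 2 * eps / 3)
  (hPsimax : Psimax = phi_star (fun i => fbar i - eta i) (g_p G) eps)
  (hpsi : potential rhat psi)
  (hmax : forall y : 'I_N -> 'cV[R]_n,
     (forall i j, E i j -> enorm (y i - y j) <= rhat) ->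
     (exists i j, E i j /\ enorm (y i - y j) = rhat) -> Psimax <= Psi E psi y)
  (hzeta : 0 < zeta) (hvartheta : 0 < vartheta)
  (hB : forall i j, E i j -> rhat + Tbar j i * Num.sqrt (2 * Psimax) <= B)
  (hc : grad_bound n psi B zeta vartheta)
  (ha : 0 < a) (hups : forall i, 0 < upsilon i)
  (hk : forall i, g_k G i >=
     \sum_(j < N | E i j) (a * (zeta + vartheta) / 2
        + (zeta + n%:R * vartheta) * Tbar i j ^+ 2 / (2 * a)) + upsilon i)
  (hbeta : \sum_(i < N) (2 * g_beta G i)^-1
       * ((param (A i) - thh x i 0)^T *m (param (A i) - thh x i 0)) 0 0
     < Psimax - Psi E psi (fun i => qh x i 0)).
(* The signals are continuous on the whole line, the proxies resting before 0. *)
Context (cq : forall i, continuous (q x i)) (cdq : forall i, continuous (dq x i))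
  (cqh : forall i, continuous (qh x i)) (cdqh : forall i, continuous (dqh x i))
  (cthh : forall i, continuous (thh x i))
  (qh_past : forall i (t : R), t <= 0 -> qh x i t = qh x i 0)
  (dqh_past : forall i (t : R), t <= 0 -> dqh x i t = 0).
(* An edge makes the bounds on [rhat] effective; without one, or in dimension 0,
   the claims are trivial. *)
Context (i0 j0 : 'I_N) (e0 : E i0 j0) (k0 : 'I_n).

Let b i := fbar i - eta i.
Let alpha := g_alpha G.
Let c0 := (zeta + n%:R * vartheta) / (2 * a).
(* Speed of a proxy whose kinetic energy is [Psimax]. *)
Let vmax := Num.sqrt (2 * Psimax).

Let b_gt0 i k : 0 < b i k 0.
Proof. by rewrite !mxE subr_gt0; case/andP: (heta i k). Qed.

Let b_ge0 i k : 0 <= b i k 0.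
Proof. exact: ltW (b_gt0 i k). Qed.

Let alpha0 : 0 < alpha. Proof. by case: hG. Qed.
Let mu0 i : 0 < g_mu G i. Proof. by case: hG => _ /(_ i)[]. Qed.
Let p0 i : 0 < g_p G i. Proof. by case: hG => _ /(_ i)[]. Qed.
Let kk0 i : 0 < g_k G i. Proof. by case: hG => _ /(_ i)[]. Qed.
Let be0 i : 0 < g_beta G i. Proof. by case: hG => _ /(_ i)[]. Qed.

Let c0_ge0 : 0 <= c0.
Proof.
by rewrite divr_ge0 ?addr_ge0 ?mulr_ge0 ?ler0n ?(ltW hzeta) ?(ltW hvartheta) ?(ltW ha).
Qed.

Let Tbar0 i j : E i j -> 0 <= Tbar j i.
Proof. by move=> Eij; have /andP[h] := hT Eij (lexx 0); exact: le_trans. Qed.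

Let rhat0 : 0 < rhat.
Proof.
have := hE0 e0; have := enorm_ge0 (q x i0 0 - q x j0 0); move: heps; rewrite hrhat; lra.
Qed.

Let rhatB : rhat <= B.
Proof.
apply: le_trans (hB e0); rewrite lerDl mulr_ge0 ?Tbar0// sqrtr_ge0.
Qed.

Let edge0 i j : E i j -> enorm (qh x i 0 - qh x j 0) < rhat.
Proof.
move=> Eij; rewrite !(cl_qh0 hx); apply: (le_lt_trans (hE0 Eij)).
by move: heps; rewrite hrhat; lra.
Qed.

Let Psi_clampedE (y : 'I_N -> 'cV[R]_n) :
  (forall i j, E i j -> enorm (y i - y j) <= rhat) ->
  Psi E (clamped_potential (psi := psi) (rhat := rhat)) y = Psi E psi y.
Proof.
move=> yr; rewrite /Psi; congr (_ * _); apply: eq_bigr => i _; apply: eq_bigr => j Eij.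
by rewrite clamped_potentialE// enorm_ge0 yr.
Qed.

Let clamped_ge0 d : 0 <= clamped_potential (psi := psi) (rhat := rhat) d.
Proof.
by apply: (pot_ge0 hpsi _).1; rewrite le_max lexx ge_max (ltW rhat0) ge_min lexx orbT.
Qed.

Let Psi_clamped_ge0 (y : 'I_N -> 'cV[R]_n) :
  0 <= Psi E (clamped_potential (psi := psi) (rhat := rhat)) y.
Proof. by rewrite mulr_ge0//; do 2 apply: sumr_ge0 => ? _. Qed.

(** The energy of agent [i] and of its proxy. *)
Definition agent_energy i (u : R) : R :=
  2^-1 * dot (surf G x i u) (inertia (A i) (q x i u) *m surf G x i u)
  + (2 * g_beta G i)^-1 * dot (param (A i) - thh x i u) (param (A i) - thh x i u)
  + 2^-1 * dot (dqh x i u) (dqh x i u)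
  + phi (fbar i - eta i) (g_p G i) (q x i u - qh x i u).

(** The inter-proxy potential, with [psi] clamped so that it is continuous in time
    before the edges are known to stay short. *)
Definition coupling_energy (u : R) : R :=
  Psi E (clamped_potential (psi := psi) (rhat := rhat)) (fun i => qh x i u).

(** For each edge, the functional of the neighbour's velocity; the weight is the
    one that the delayed gradient costs. *)
Definition delay_energy (u : R) : R :=
  \sum_(i < N) \sum_(j < N | E i j)
    (zeta + n%:R * vartheta) / (2 * a) * krasovskii (dqh x j) (Tbar j i) u.

(** The Lyapunov-Krasovskii functional. *)
Definition lyapunov (u : R) : R :=
  \sum_(i < N) agent_energy i u + coupling_energy u + delay_energy u.

(** The position of proxy [j] as known to agent [i]. *)
Definition delayed i j (t : R) : 'cV[R]_n := qh x j (t - T j i t).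

Lemma err_der i (t : R) : 0 < t -> mxder (err G x i) t (derr G x i t).
Proof.
move=> t0; apply: mxderZ; apply: mxderB; apply: is_derive_mxder.
  exact: cl_q hx i t t0.
exact: cl_qh hx i t t0.
Qed.

(** The levels of the inner saturation leave room for the dynamic compensation, so
    the actuators never saturate. *)
Lemma actuation_unsaturated i (t : R) : 0 <= t ->
  satv (fbar i) (fhat A fbar eta G x i t) = fhat A fbar eta G x i t.
Proof.
move=> t0; apply/colP => k; rewrite mxE sat_id//.
have h1 := hPhi i k t0.
have h2 := sat_abs ((g_mu G i *: surf G x i t + err G x i t) k 0) (b_ge0 i k).
rewrite /fhat [X in `|X|]mxE [X in _ + X]mxE.
apply: (le_trans (ler_normB _ _)).
have -> : fbar i k 0 = eta i k 0 + b i k 0 by rewrite /b !mxE; ring.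
by apply: lerD => //; rewrite /satpd [X in `|X|]mxE.
Qed.

Lemma agent_energy_der i (t : R) : 0 < t -> exists2 D, is_derive t 1 (agent_energy i) D &
  D <= - (alpha * dot (satv (b i) (err G x i t)) (err G x i t))
       - g_k G i * dot (dqh x i t) (dqh x i t)
       - \sum_(j < N | E i j) dot (dqh x i t) (grad psi (qh x i t) (delayed i j t)).
Proof.
move=> t0.
have [ddq dv dyn] := cl_dq hx i t0.
rewrite (actuation_unsaturated _ (ltW t0)) /fhat in dyn.
set w := satpd _ _ _ _ in dyn.
have d1 := sliding_energy_der (hA i) (cl_q hx i t0) dv (err_der i t0) dyn.
have d2 := adaptation_energy_der (A i) (be0 i) (is_derive_mxder (cl_thh hx i t0)).
have dh := is_derive_mxder (cl_dqh hx i t0).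
have d3 := derZ 2^-1 (der_dot_sqr dh).
have d4 := phi_der (b i) (g_p G i)
  (mxderB (is_derive_mxder (cl_q hx i t0)) (is_derive_mxder (cl_qh hx i t0))).
have dE := derD (derD (derD d1 d2) d3) d4.
rewrite -/(Phi A G x i t) -/(surf G x i t) in dE.
eexists; first exact: dE.
rewrite -/(err G x i t).
set s := surf G x i t; set e := err G x i t; set v := dqh x i t.
set P := Phi A G x i t; set th := thh x i t; set om := omega A G x i t.
set pr := Defs.projv _ _ _ _ _.
(* The power of the parameter error in the sliding dynamics is the one that the
   unprojected adaptation law compensates. *)
have bal : dot s (P *m (param (A i) - th)) = - ((g_beta G i)^-1 * dot (param (A i) - th) om).
  by rewrite /om /omega -/P -/s dotZr dot_mulmx dotC; field; rewrite gt_eqF.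
have dsc : (g_beta G i)^-1 * dot (param (A i) - th) (om - pr) <= 0.
  rewrite mulr_ge0_le0 ?invr_ge0 ?(ltW (be0 i))//.
  by apply: projv_descent => // k; exact: htheta.
have sd := sat_descent (b i) s e (mu0 i).
have vs : dq x i t = s - alpha *: e by rewrite /s /surf -/e addrK.
move: dsc sd; rewrite vs !dotBr bal /w /satpd -/(b i) -/s -/e mulrBr.
rewrite !dotZr dot_sumr.
rewrite (dotC v (satv (b i) e)) (dotC s (satv (b i) e)).
lra.
Qed.

(** The edges are short enough for the potential to be differentiable, and the
    proxies slow enough for delayed positions to stay within reach of the gradient
    bound. *)
Definition admissible (t : R) : Prop :=
  (forall i j, E i j -> enorm (qh x i t - qh x j t) < rhat) /\
  (forall j, 2^-1 * dot (dqh x j t) (dqh x j t) < Psimax).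

Lemma edge_sum_swap (F : 'I_N -> 'I_N -> R) :
  \sum_(i < N) \sum_(j < N | E i j) F i j = \sum_(i < N) \sum_(j < N | E i j) F j i.
Proof.
rewrite (exchange_big_dep xpredT)//=; apply: eq_bigr => i _.
by apply: eq_bigl => j; rewrite hEsym.
Qed.

Lemma grad_antisym y z : enorm (y - z) < rhat -> grad psi y z = - grad psi z y :> 'cV[R]_n.
Proof.
move=> yz; have [lam lamP] := potential_slope hpsi.
by rewrite (grad_lam lamP yz) (grad_lam lamP) enormC// -scalerN opprB.
Qed.

Lemma coupling_energy_der (t : R) : 0 < t -> admissible t ->
  is_derive t 1 coupling_energy
    (\sum_(i < N) \sum_(j < N | E i j) dot (dqh x i t) (grad psi (qh x i t) (qh x j t))).
Proof.
move=> t0 [edge _]; have [lam lamP] := potential_slope hpsi.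
have hv i j : mxder (fun u => qh x i u - qh x j u) t (dqh x i t - dqh x j t).
  by apply: mxderB; apply: is_derive_mxder; exact: (cl_qh hx).
have dE : is_derive t 1 coupling_energy (2^-1 * \sum_(i < N) \sum_(j < N | E i j)
    (2 * lam (enorm (qh x i t - qh x j t))
      * dot (qh x i t - qh x j t) (dqh x i t - dqh x j t))).
  apply: derZ; apply: der_sum => i _; apply: der_sum => j Eij.
  by apply: (clamped_potential_der lamP) => //; exact: edge.
refine (der_eq dE _).
pose F i j := dot (dqh x i t) (grad psi (qh x i t) (qh x j t)).
have -> : \sum_(i < N) \sum_(j < N | E i j)
    (2 * lam (enorm (qh x i t - qh x j t))
      * dot (qh x i t - qh x j t) (dqh x i t - dqh x j t)) =
    \sum_(i < N) \sum_(j < N | E i j) (F i j + F j i).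
  apply: eq_bigr => i _; apply: eq_bigr => j Eij.
  have ed : enorm (qh x j t - qh x i t) < rhat by rewrite enormC edge.
  rewrite /F (grad_antisym ed) (grad_lam lamP) ?edge//.
  by rewrite !(dotNr, dotZr) -mulrN -mulrDr -dotNl -dotDl [in RHS]dotC.
under eq_bigr do rewrite big_split /=.
by rewrite big_split /= -[X in _ + X]edge_sum_swap; field.
Qed.

Lemma coord_cont (y : R -> 'cV[R]_n) : continuous y -> forall k, continuous (fun u => y u k 0).
Proof. by move=> cy k; exact: continuous_coord. Qed.

Lemma delay_energy_der (t : R) : is_derive t 1 delay_energy
  (\sum_(i < N) \sum_(j < N | E i j) c0 * (Tbar j i ^+ 2 * speed2 (dqh x j) t
     - Tbar j i * (travel (dqh x j) t - travel (dqh x j) (t - Tbar j i)))).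
Proof.
apply: der_sum => i _; apply: der_sum => j _; apply: derZ; apply: krasovskii_der.
exact: coord_cont.
Qed.

Lemma speed_le j k (t : R) : admissible t -> `|dqh x j t k 0| <= vmax.
Proof.
move=> [_ /(_ j) kin]; apply: le_trans (coord_enorm _ _) _.
by rewrite enormE ler_wsqrtr//; move: kin; lra.
Qed.

Lemma displacement_coord i k (s t : R) : 0 <= s -> s <= t ->
  (forall u, 0 <= u < t -> admissible u) -> `|qh x i t k 0 - qh x i s k 0| <= vmax * (t - s).
Proof.
move=> s0 st adm; apply: (bounded_der_lipschitz (f := fun u => qh x i u k 0)) => //.
  exact: coord_cont.
move=> u /andP[su ut]; exists (dqh x i u k 0).
  by apply: is_derive_mxder; apply: (cl_qh hx); exact: le_lt_trans su.
by apply: speed_le; apply: adm; rewrite ut (le_trans s0 (ltW su)).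
Qed.

Lemma delayed_displacement_coord i j k (t : R) : E i j -> 0 <= t ->
  (forall u, 0 <= u < t -> admissible u) ->
  `|qh x j t k 0 - delayed i j t k 0| <= vmax * Tbar j i.
Proof.
move=> Eij t0 adm; have /andP[T0 TT] := hT Eij t0; rewrite /delayed.
have -> : qh x j (t - T j i t) = qh x j (Num.max 0 (t - T j i t)).
  by case: (lerP 0 (t - T j i t)) => // /ltW /qh_past.
apply: (le_trans (displacement_coord _ _ _ _ adm)).
- by rewrite le_max lexx.
- by rewrite ge_max t0 gerBl.
rewrite ler_wpM2l ?sqrtr_ge0//; apply: le_trans TT.
by rewrite lerBlDl -lerBlDr le_max lexx orbT.
Qed.

Lemma neighbour_in_range i j k (t : R) : E i j -> admissible t ->
  `|qh x i t k 0 - qh x j t k 0| <= B.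
Proof.
move=> Eij [edge _]; have := coord_enorm (qh x i t - qh x j t) k.
rewrite !mxE => /le_trans; apply; apply: le_trans rhatB; exact: ltW (edge _ _ Eij).
Qed.

Lemma delayed_in_range i j k (t : R) : E i j -> 0 <= t ->
  (forall u, 0 <= u <= t -> admissible u) -> `|qh x i t k 0 - delayed i j t k 0| <= B.
Proof.
move=> Eij t0 adm.
have adm' u : 0 <= u < t -> admissible u by move=> /andP[u0 /ltW ut]; apply: adm; rewrite u0.
have [edge _] : admissible t by apply: adm; rewrite t0 lexx.
apply: le_trans (hB Eij).
have h1 := delayed_displacement_coord k Eij t0 adm'.
have h2 := coord_enorm (qh x i t - qh x j t) k; rewrite !mxE in h2.
have h3 := edge _ _ Eij.
rewrite -(subrK (qh x j t k 0) (qh x i t k 0)) -addrA (mulrC (Tbar j i)).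
apply: (le_trans (ler_normD _ _)); apply: lerD => //; exact: le_trans h2 (ltW h3).
Qed.

Lemma grad_delay_bound i j k (t : R) : E i j -> 0 <= t ->
  (forall u, 0 <= u <= t -> admissible u) ->
  `|(grad psi (qh x i t) (qh x j t) - grad psi (qh x i t) (delayed i j t)) k 0| <=
  zeta * `|(qh x j t - delayed i j t) k 0| + vartheta * `|qh x j t - delayed i j t|.
Proof.
move=> Eij t0 adm; rewrite !colB; apply: hc => l.
  by apply: neighbour_in_range => //; apply: adm; rewrite t0 lexx.
exact: delayed_in_range.
Qed.

(** Guaranteed rate of decrease of the functional. *)
Definition dissipation (t : R) : R :=
  \sum_(i < N) (alpha * dot (satv (b i) (err G x i t)) (err G x i t)
                + upsilon i * dot (dqh x i t) (dqh x i t)).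

Lemma lyapunov_der (t : R) : 0 < t -> (forall u, 0 <= u <= t -> admissible u) ->
  exists2 D, is_derive t 1 lyapunov D & D <= - dissipation t.
Proof.
move=> t0 adm.
have /choice[dA hdA] : forall i, exists D, is_derive t 1 (agent_energy i) D /\
  D <= - (alpha * dot (satv (b i) (err G x i t)) (err G x i t))
       - g_k G i * dot (dqh x i t) (dqh x i t)
       - \sum_(j < N | E i j) dot (dqh x i t) (grad psi (qh x i t) (delayed i j t)).
  by move=> i; have [D d1 d2] := agent_energy_der i t0; exists D.
have admt : admissible t by apply: adm; rewrite lexx ltW.
have d1 : is_derive t 1 (fun u => \sum_(i < N) agent_energy i u) (\sum_(i < N) dA i).
  by apply: der_sum => i _; case: (hdA i).
pose v i := dqh x i t.
pose S i j := Tbar j i * (travel (dqh x j) t - travel (dqh x j) (t - Tbar j i)).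
have d2 : is_derive t 1 coupling_energy (\sum_(i < N) \sum_(j < N | E i j)
    dot (v i) (grad psi (qh x i t) (qh x j t))) := coupling_energy_der t0 admt.
have d3 : is_derive t 1 delay_energy (\sum_(i < N) \sum_(j < N | E i j)
    c0 * (Tbar j i ^+ 2 * speed2 (dqh x j) t - S i j)) := delay_energy_der t.
eexists; first exact: (derD (derD d1 d2) d3).
have hS i j : E i j -> dot (v i) (grad psi (qh x i t) (qh x j t)
      - grad psi (qh x i t) (delayed i j t)) <=
    a * (zeta + vartheta) / 2 * dot (v i) (v i) + c0 * S i j.
  move=> Eij; apply: (@perturbation_power _ _ _ _ _ _ _ (qh x j t - delayed i j t)) => //.
    by move=> k; apply: grad_delay_bound => //; exact: ltW.
  apply: displacement_le => //.
  - exact: coord_cont.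
  - exact: coord_cont.
  - exact: qh_past.
  - by move=> u u0; apply: is_derive_mxder; exact: (cl_qh hx).
  - exact: ltW.
  - by apply: hT => //; exact: ltW.
rewrite /dissipation -sumrN.
pose Q i := - (alpha * dot (satv (b i) (err G x i t)) (err G x i t))
       - g_k G i * dot (v i) (v i).
(* The delay terms [S] cancel, leaving a cost in the speeds of both ends of the
   edges; exchanging the ends moves it to agent [i], whose damping covers it. *)
apply: (@le_trans _ _ (\sum_(i < N) (Q i + \sum_(j < N | E i j)
    (a * (zeta + vartheta) / 2 * dot (v i) (v i)
     + c0 * Tbar j i ^+ 2 * dot (v j) (v j))))).
  rewrite -!big_split /=; apply: ler_sum => i _.
  apply: (@le_trans _ _ (Q i + \sum_(j < N | E i j)
      (dot (v i) (grad psi (qh x i t) (qh x j t) - grad psi (qh x i t) (delayed i j t))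
       + c0 * (Tbar j i ^+ 2 * speed2 (dqh x j) t - S i j)))).
    rewrite big_split /=; under [X in _ + (X + _)]eq_bigr do rewrite dotBr.
    rewrite sumrB !addrA lerD2r addrAC lerD2r.
    exact: (hdA i).2.
  rewrite lerD2l; apply: ler_sum => j Eij; have := hS i j Eij.
  rewrite /speed2 -/(v j); lra.
have -> : \sum_(i < N) (Q i + \sum_(j < N | E i j)
    (a * (zeta + vartheta) / 2 * dot (v i) (v i)
     + c0 * Tbar j i ^+ 2 * dot (v j) (v j))) =
  \sum_(i < N) (Q i + \sum_(j < N | E i j)
    (a * (zeta + vartheta) / 2 + c0 * Tbar i j ^+ 2) * dot (v i) (v i)).
  rewrite !big_split /=; congr (_ + _).
  under eq_bigr do rewrite big_split /=.
  rewrite big_split /= [X in _ + X]edge_sum_swap -big_split /=.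
  apply: eq_bigr => i _; rewrite -big_split /=; apply: eq_bigr => j _; ring.
apply: ler_sum => i _; rewrite -mulr_suml.
have := ler_wpM2r (dot_ge0 (v i)) (hk i).
have -> : \sum_(j < N | E i j) (a * (zeta + vartheta) / 2
      + (zeta + n%:R * vartheta) * Tbar i j ^+ 2 / (2 * a)) =
    \sum_(j < N | E i j) (a * (zeta + vartheta) / 2 + c0 * Tbar i j ^+ 2).
  by apply: eq_bigr => j _; rewrite /c0; ring.
rewrite /Q -/(v i) mulrDl; lra.
Qed.

Lemma dissipation_ge (t : R) i : alpha * dot (satv (b i) (err G x i t)) (err G x i t)
  + upsilon i * dot (dqh x i t) (dqh x i t) <= dissipation t.
Proof.
rewrite /dissipation (bigD1 i)//= lerDl; apply: sumr_ge0 => j _.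
by rewrite addr_ge0// mulr_ge0 ?dot_ge0 ?satv_mul_ge0 ?(ltW alpha0) ?(ltW (hups j)).
Qed.

Lemma dissipation_ge0 (t : R) : 0 <= dissipation t.
Proof.
apply: le_trans (dissipation_ge t i0).
by rewrite addr_ge0// mulr_ge0 ?dot_ge0 ?satv_mul_ge0 ?(ltW alpha0) ?(ltW (hups i0)).
Qed.

Lemma continuous_err i : continuous (err G x i).
Proof.
move=> t; apply: cvgZ; first exact: cvg_cst.
by apply: cvgB; [exact: cq | exact: cqh].
Qed.

Lemma continuous_surf i : continuous (surf G x i).
Proof.
move=> t; apply: cvgD; first exact: cdq.
by apply: cvgZ; [exact: cvg_cst | exact: continuous_err].
Qed.

Lemma continuous_inertia i : continuous (fun u => inertia (A i) (q x i u)).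
Proof.
have [_ p2 _ _] := hA i => u.
apply: (continuous_comp (f := q x i) (g := inertia (A i))); first exact: cq.
by apply: differentiable_continuous; case: (p2 (q x i u) 0).
Qed.

Lemma continuous_lyapunov : continuous lyapunov.
Proof.
have cc (c : R) (f : R -> R) : continuous f -> continuous (fun u => c * f u).
  by move=> cf u; apply: cvgM; [exact: cvg_cst | exact: cf].
have cag i : continuous (agent_energy i).
  move=> u; apply: cvgD; [apply: cvgD; [apply: cvgD|] |].
  - apply: cc; apply: continuous_dot; first exact: continuous_surf.
    by apply: continuous_mulmx; [exact: continuous_inertia | exact: continuous_surf].
  - by apply: cc; apply: continuous_dot => w; apply: cvgB;
      (exact: cvg_cst || exact: cthh).
  - by apply: cc; apply: continuous_dot.
  - by apply: continuous_phi => w; apply: cvgB; [exact: cq | exact: cqh].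
move=> u; apply: cvgD; first apply: cvgD.
- by move: u; apply: continuous_bigsum => i _; exact: cag.
- apply: cc; apply: continuous_bigsum => i _; apply: continuous_bigsum => j _ w.
  apply: (continuous_comp (f := fun u => enorm (qh x i u - qh x j u))
      (g := clamped_potential (psi := psi) (rhat := rhat))).
    by apply: continuous_enorm => z; apply: cvgB; exact: cqh.
  exact: continuous_clamped_potential.
- move: u; apply: continuous_bigsum => i _; apply: continuous_bigsum => j _.
  apply: cc; apply: continuous_krasovskii.
  exact: coord_cont.
Qed.

Lemma agent_energy_terms i (t : R) :
  [/\ 0 <= dot (surf G x i t) (inertia (A i) (q x i t) *m surf G x i t),
      0 <= (2 * g_beta G i)^-1 * dot (param (A i) - thh x i t) (param (A i) - thh x i t),
      0 <= dot (dqh x i t) (dqh x i t) &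
      0 <= phi (fbar i - eta i) (g_p G i) (q x i t - qh x i t)].
Proof.
split; last by apply: phi_ge0 => //; exact: (b_ge0 i).
- exact: inertia_energy_ge0.
- by rewrite mulr_ge0 ?dot_ge0// invr_ge0 mulr_ge0// ltW.
- exact: dot_ge0.
Qed.

Lemma agent_energy_ge0 i (t : R) : 0 <= agent_energy i t.
Proof. by have [? ? ? ?] := agent_energy_terms i t; rewrite /agent_energy; lra. Qed.

Lemma delay_energy_ge0 (t : R) : 0 <= delay_energy t.
Proof.
apply: sumr_ge0 => i _; apply: sumr_ge0 => j Eij; apply: mulr_ge0 => //.
by apply: krasovskii_ge0; [exact: coord_cont | exact: Tbar0].
Qed.

Lemma agent_energy_le i (t : R) : agent_energy i t <= lyapunov t.
Proof.
have h1 := delay_energy_ge0 t; have h2 := Psi_clamped_ge0 (fun i => qh x i t).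
have h3 : agent_energy i t <= \sum_(i < N) agent_energy i t.
  by rewrite (bigD1 i)//= lerDl; apply: sumr_ge0 => j _; exact: agent_energy_ge0.
by rewrite /lyapunov /coupling_energy; lra.
Qed.

Lemma lyapunov_ge0 (t : R) : 0 <= lyapunov t.
Proof. exact: le_trans (agent_energy_ge0 i0 t) (agent_energy_le i0 t). Qed.

Lemma coupling_energy_le (t : R) : coupling_energy t <= lyapunov t.
Proof.
have h1 := delay_energy_ge0 t.
have h3 : 0 <= \sum_(i < N) agent_energy i t.
  by apply: sumr_ge0 => j _; exact: agent_energy_ge0.
by rewrite /lyapunov; lra.
Qed.

Lemma lyapunov0 : lyapunov 0 < Psimax.
Proof.
have z : dot (0 : 'cV[R]_n) 0 = 0 by rewrite -(scale0r (0 : 'cV[R]_n)) dotZl mul0r.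
have W0 : delay_energy 0 = 0.
  rewrite /delay_energy big1// => i _; rewrite big1// => j Eij.
  rewrite krasovskii0 ?mulr0//; [exact: coord_cont | exact: dqh_past | exact: Tbar0].
have P0 : coupling_energy 0 = Psi E psi (fun i => qh x i 0).
  by apply: Psi_clampedE => i j Eij; exact: ltW (edge0 Eij).
have A0 i : agent_energy i 0 = (2 * g_beta G i)^-1
       * ((param (A i) - thh x i 0)^T *m (param (A i) - thh x i 0)) 0 0.
  have e00 : err G x i 0 = 0 by rewrite /err (cl_qh0 hx) subrr scaler0.
  have s0 : surf G x i 0 = 0 by rewrite /surf hrest e00 scaler0 addr0.
  rewrite /agent_energy s0 mulmx0 (cl_dqh0 hx) z (cl_qh0 hx) subrr phi0 dotE; ring.
rewrite /lyapunov W0 P0 addr0 (eq_bigr _ (fun i _ => A0 i)).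
by move: hbeta; rewrite ltrBrDr.
Qed.

Lemma lyapunov_le (s t : R) : 0 <= s -> s <= t ->
  (forall u, 0 <= u < t -> admissible u) -> lyapunov t <= lyapunov s.
Proof.
move=> s0 st adm; rewrite -subr_le0 -[leRHS](mul0r (t - s)); apply: der_le => //.
  by apply: continuous_subspaceT; exact: continuous_lyapunov.
move=> u /andP[su ut]; have [||D dD Dle] := @lyapunov_der u.
- exact: le_lt_trans su.
- by move=> w /andP[w0 wu]; apply: adm; rewrite w0 (le_lt_trans wu).
by exists D => //; apply: le_trans Dle _; rewrite oppr_le0 dissipation_ge0.
Qed.

Lemma kinetic_lt i (t : R) : lyapunov t < Psimax ->
  2^-1 * dot (dqh x i t) (dqh x i t) < Psimax.
Proof.
move=> V; have := agent_energy_le i t; have [? ? ? ?] := agent_energy_terms i t.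
by rewrite /agent_energy; lra.
Qed.

(** The trajectory never leaves the admissible region: an edge of length [rhat]
    would cost more energy than is available. *)
Lemma admissible_forever (t : R) : 0 <= t -> admissible t.
Proof.
move: t; apply: real_induction.
- split; first exact: edge0.
  by move=> j; apply: kinetic_lt; exact: lyapunov0.
- move=> t t0 adm.
  have V : lyapunov t < Psimax.
    by apply: le_lt_trans lyapunov0; apply: lyapunov_le => //; exact: ltW.
  have edge i j : E i j -> enorm (qh x i t - qh x j t) <= rhat.
    move=> Eij; apply: (continuous_le_left (f := fun u => enorm (qh x i u - qh x j u))) => //.
      by apply: continuous_enorm => z; apply: cvgB; exact: cqh.
    by move=> s /adm[/(_ _ _ Eij)/ltW].
  split; last by move=> j; exact: kinetic_lt.
  move=> i j Eij; rewrite lt_neqAle edge// andbT; apply/eqP => dr.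
  have : Psimax <= Psi E psi (fun i => qh x i t) by apply: hmax => //; exists i, j.
  rewrite -Psi_clampedE// => h; have := le_lt_trans (coupling_energy_le t) V.
  by rewrite ltNge h.
- move=> t _ [edge kin].
  have h1 (e : 'I_N * 'I_N) :
      \forall s \near t, E e.1 e.2 -> enorm (qh x e.1 s - qh x e.2 s) < rhat.
    case: (boolP (E e.1 e.2)) => [Ee|_]; last by exists 1 => [|s _] /=.
    have ce : continuous (fun u => enorm (qh x e.1 u - qh x e.2 u)).
      by apply: continuous_enorm => z; apply: cvgB; exact: cqh.
    by apply: filterS (cvgr_lt _ (ce t) _ (edge _ _ Ee)) => s hs _.
  have h2 j : \forall s \near t, 2^-1 * dot (dqh x j s) (dqh x j s) < Psimax.
    have ce : continuous (fun u => 2^-1 * dot (dqh x j u) (dqh x j u)).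
      by move=> u; apply: cvgM; [exact: cvg_cst | apply: continuous_dot].
    exact: (cvgr_lt _ (ce t) _ (kin j)).
  have h1' := filter_forall _ h1; have h2' := filter_forall _ h2.
  near=> s; split; last by near: s; exact: h2'.
  suff h e : E e.1 e.2 -> enorm (qh x e.1 s - qh x e.2 s) < rhat.
    by move=> i j; exact: (h (i, j)).
  by move: e; near: s; exact: h1'.
Unshelve. all: by end_near. Qed.

Lemma lyapunov_lt (t : R) : 0 <= t -> lyapunov t < Psimax.
Proof.
move=> t0; apply: le_lt_trans lyapunov0; apply: lyapunov_le => // u /andP[u0 _].
exact: admissible_forever.
Qed.

Lemma lyapunov_nonincreasing (s t : R) : 0 <= s -> s <= t -> lyapunov t <= lyapunov s.
Proof.
by move=> s0 st; apply: lyapunov_le => // u /andP[u0 _]; exact: admissible_forever.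
Qed.

Lemma agent_proxy_lt i (t : R) : 0 <= t -> enorm (q x i t - qh x i t) < eps / 3.
Proof.
move=> t0; apply: (@phi_star_lt _ _ _ (fun i => fbar i - eta i) (g_p G) eps i) => //.
rewrite -hPsimax; have := lyapunov_lt t0; have := agent_energy_le i t.
by have [? ? ? ?] := agent_energy_terms i t; rewrite /agent_energy; lra.
Qed.

Lemma connectivity i j (t : R) : 0 <= t -> E i j -> enorm (q x i t - q x j t) < r.
Proof.
move=> t0 Eij; have [edge _] := admissible_forever t0.
have h1 := agent_proxy_lt i t0; have h2 := agent_proxy_lt j t0; have h3 := edge _ _ Eij.
have -> : q x i t - q x j t =
    (q x i t - qh x i t) + (qh x i t - qh x j t) + (qh x j t - q x j t).
  by apply/colP => k; rewrite !mxE; ring.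
have h4 := enormD ((q x i t - qh x i t) + (qh x i t - qh x j t)) (qh x j t - q x j t).
have h5 := enormD (q x i t - qh x i t) (qh x i t - qh x j t).
rewrite (enormC (qh x j t)) in h4; move: h3; rewrite hrhat; lra.
Qed.

Lemma lyapunov_decay (c s t : R) : 0 <= s -> s <= t ->
  (forall u, s < u < t -> c <= dissipation u) ->
  lyapunov t - lyapunov s <= - c * (t - s).
Proof.
move=> s0 st diss; apply: der_le => //.
  by apply: continuous_subspaceT; exact: continuous_lyapunov.
move=> u sut; have [||D dD Dle] := @lyapunov_der u.
- by case/andP: sut => su _; exact: le_lt_trans su.
- by move=> w /andP[w0 _]; exact: admissible_forever.
by exists D => //; apply: le_trans Dle _; rewrite lerN2 diss.
Qed.

(** The acceleration of proxy [i], as prescribed by its dynamics. *)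
Definition acceleration i (t : R) : 'cV[R]_n :=
  satpd fbar eta i (err G x i t)
  - \sum_(j < N | E i j) grad psi (qh x i t) (delayed i j t) - g_k G i *: dqh x i t.

Lemma velocity_der i k (t : R) : 0 < t ->
  is_derive t 1 (fun u => dqh x i u k 0) (acceleration i t k 0).
Proof. by move=> t0; apply: is_derive_mxder; exact: (cl_dqh hx). Qed.

Lemma sum_edges_le i (F : 'I_N -> R) c : 0 <= c -> (forall j, E i j -> F j <= c) ->
  \sum_(j < N | E i j) F j <= N%:R * c.
Proof.
move=> c0' Fc; have -> : N%:R * c = \sum_(j < N) c by rewrite sumr_const card_ord mulr_natl.
by rewrite big_mkcond /=; apply: ler_sum => j _; case: ifPn => // Eij; exact: Fc.
Qed.

Lemma acceleration_bound i k : exists2 D, 0 < D &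
  forall t : R, 0 < t -> `|acceleration i t k 0| <= D.
Proof.
pose C := (zeta + vartheta) * B.
have C0 : 0 <= C.
  by rewrite mulr_ge0 ?addr_ge0 ?(ltW hzeta) ?(ltW hvartheta) ?(le_trans (ltW rhat0)).
have v0 : 0 <= vmax := sqrtr_ge0 _.
have NC : 0 <= N%:R * C by rewrite mulr_ge0.
have kv : 0 <= g_k G i * vmax by rewrite mulr_ge0 ?(ltW (kk0 i)).
exists (b i k 0 + N%:R * C + g_k G i * vmax); first by have := b_gt0 i k; lra.
move=> t t0; rewrite /acceleration !colB.
have adm u : 0 <= u <= t -> admissible u by case/andP => ? _; exact: admissible_forever.
apply: (le_trans (ler_normB _ _)); apply: lerD; last first.
  rewrite mxE normrM gtr0_norm//; apply: ler_wpM2l; first exact: ltW.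
  by apply: speed_le; exact: admissible_forever (ltW t0).
apply: (le_trans (ler_normB _ _)); apply: lerD.
  by rewrite [X in `|X|]mxE -colB; apply: sat_abs; exact: (b_ge0 i).
rewrite summxE; apply: (le_trans (ler_norm_sum _ _ _)); apply: sum_edges_le => // j Eij.
have [lam lamP] := potential_slope hpsi.
apply: (grad_bounded hc rhat0 rhatB hzeta hvartheta lamP) => l.
by apply: delayed_in_range => //; exact: ltW.
Qed.

Lemma velocity_vanishes i k : vanishes (fun t => dqh x i t k 0).
Proof.
have [D D0 hD] := acceleration_bound i k.
apply: (barbalat (L := lyapunov) (m := 0) D0).
- by move=> t _; exact: lyapunov_ge0.
- exact: lyapunov_nonincreasing.
- move=> s t s0 st; apply: (bounded_der_lipschitz (f := fun u => dqh x i u k 0)) => //.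
    exact: coord_cont.
  move=> u /andP[su _]; have u0 : 0 < u by exact: le_lt_trans su.
  by exists (acceleration i u k 0); [exact: velocity_der | exact: hD].
move=> e e0'; exists (upsilon i * e ^+ 2); first by rewrite mulr_gt0 ?exprn_gt0.
move=> s t s0 st big; apply: lyapunov_decay => // u /big eu.
apply: le_trans (dissipation_ge u i); rewrite ler_wpDl//.
  by rewrite mulr_ge0 ?satv_mul_ge0 ?(ltW alpha0).
rewrite ler_wpM2l ?(ltW (hups i))//; apply: le_trans (sqr_coord_le _ k).
by rewrite -[leRHS]real_normK ?num_real// ler_pXn2r ?nnegrE// ltW.
Qed.

(** The sliding variable and the error are bounded by the energy, hence so is the
    velocity of the agent. *)
Lemma error_rate_bound i k : exists2 D, 0 < D &
  forall t : R, 0 < t -> `|derr G x i t k 0| <= D.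
Proof.
have [l l0 hl] := inertia_energy_bound (hA i).
pose S := Num.sqrt (2 * Psimax / l).
pose C := S + alpha * (g_p G i * (eps / 3)) + vmax.
have C0 : 0 <= C.
  rewrite !addr_ge0 ?sqrtr_ge0// mulr_ge0 ?(ltW alpha0)//.
  by rewrite mulr_ge0 ?(ltW (p0 i))// divr_ge0// ltW.
exists (g_p G i * C + 1); first by rewrite ltr_wpDl// mulr_ge0 ?(ltW (p0 i)).
move=> t t0; rewrite /derr mxE normrM gtr0_norm// ler_wpDr//.
apply: ler_wpM2l; first exact: ltW.
rewrite colB; apply: (le_trans (ler_normB _ _)); apply: lerD; last first.
  by apply: speed_le; exact: admissible_forever (ltW t0).
apply: (le_trans (coord_enorm _ _)).
have -> : dq x i t = surf G x i t - alpha *: err G x i t by rewrite /surf addrK.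
apply: (le_trans (enormD _ _)); rewrite enormN enormZ gtr0_norm//; apply: lerD.
  have hs := hl (q x i t) (surf G x i t).
  have := lyapunov_lt (ltW t0); have := agent_energy_le i t.
  have [? ? ? ?] := agent_energy_terms i t; rewrite /agent_energy => h1 h2.
  rewrite -[leLHS]ger0_norm ?enorm_ge0// -sqrtr_sqr; apply: ler_wsqrtr.
  by rewrite ler_pdivlMr// mulrC; lra.
apply: ler_wpM2l; first exact: ltW.
rewrite /err enormZ gtr0_norm//; apply: ler_wpM2l; first exact: ltW.
by apply: ltW; apply: agent_proxy_lt; exact: ltW.
Qed.

Lemma error_vanishes i k : vanishes (fun t => err G x i t k 0).
Proof.
have [D D0 hD] := error_rate_bound i k.
apply: (barbalat (L := lyapunov) (m := 0) D0).
- by move=> t _; exact: lyapunov_ge0.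
- exact: lyapunov_nonincreasing.
- move=> s t s0 st; apply: (bounded_der_lipschitz (f := fun u => err G x i u k 0)) => //.
    by apply: coord_cont; exact: continuous_err.
  move=> u /andP[su _]; have u0 : 0 < u by exact: le_lt_trans su.
  by exists (derr G x i u k 0); [exact: err_der | exact: hD].
move=> e e0'; exists (alpha * (Num.min (b i k 0) e * e)).
  by rewrite !mulr_gt0// lt_min b_gt0.
move=> s t s0 st big; apply: lyapunov_decay => // u /big eu.
apply: le_trans (dissipation_ge u i); rewrite ler_wpDr//.
  by rewrite mulr_ge0 ?dot_ge0 ?(ltW (hups i)).
rewrite ler_wpM2l ?(ltW alpha0)//.
apply: (le_trans (sat_mul_min (b_ge0 i k) (ltW e0') eu)).
exact: satv_mul_coord (b_ge0 i).
Qed.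

Lemma delayed_displacement_vanishes i j : E i j ->
  vanishes (fun t => `|qh x j t - delayed i j t|).
Proof.
move=> Eij e e0'; have TT0 := Tbar0 Eij.
have T10 : 0 < Tbar j i + 1 by rewrite ltr_wpDl.
have hv : vanishes (fun t => \sum_k `|dqh x j t k 0|).
  by apply: vanishes_sum => k _; apply: vanishes_norm; exact: velocity_vanishes.
have [|S hS] := hv (e / (Tbar j i + 1)); first by rewrite divr_gt0.
exists (Num.max 0 S + Tbar j i) => t St.
have t0 : 0 <= t by apply: le_trans St; rewrite addr_ge0// le_max lexx.
have /andP[T0 TT] := hT Eij t0; rewrite normr_id; apply: norm_le; first exact: ltW.
move=> k; rewrite colB /delayed; set s := t - T j i t.
have sS : Num.max 0 S <= s by rewrite /s lerBrDr (le_trans _ St)// lerD2l.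
have s0 : 0 <= s by apply: le_trans sS; rewrite le_max lexx.
have st : s <= t by rewrite gerBl.
apply: (@le_trans _ _ (e / (Tbar j i + 1) * (t - s))).
  apply: (bounded_der_lipschitz (f := fun u => qh x j u k 0)) => //.
    exact: coord_cont.
  move=> u /andP[su _]; exists (dqh x j u k 0).
    by apply: is_derive_mxder; apply: (cl_qh hx); exact: le_lt_trans su.
  have Su : S <= u.
    by apply: ltW; apply: le_lt_trans su; apply: le_trans sS; rewrite le_max lexx orbT.
  have := hS u Su; rewrite ger0_norm ?sumr_ge0//; apply: le_trans.
  by rewrite (bigD1 k)//= lerDl sumr_ge0.
rewrite mulrAC ler_pdivrMr// ler_pM2l// /s subKr (le_trans TT)// lerDl ler01//.
Qed.

(** Total force exerted on proxy [i] by its undelayed neighbours. *)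
Definition force i (t : R) : 'cV[R]_n :=
  \sum_(j < N | E i j) grad psi (qh x i t) (qh x j t).

Lemma force_lipschitz i k : exists2 D, 0 < D & forall s t : R, 0 <= s -> s <= t ->
  `|force i t k 0 - force i s k 0| <= D * (t - s).
Proof.
have [lam lamP] := potential_slope hpsi.
have v0 : 0 <= vmax := sqrtr_ge0 _.
have zv : 0 < zeta + vartheta by rewrite addr_gt0.
pose C := (zeta + vartheta) * (2 * vmax).
have C0 : 0 <= C by rewrite !mulr_ge0// ltW.
exists (N%:R * C + 1); first by rewrite ltr_wpDl// mulr_ge0.
move=> s t s0 st; have t0 : 0 <= t by exact: le_trans st.
have ts0 : 0 <= t - s by rewrite subr_ge0.
have NC : N%:R * (C * (t - s)) <= (N%:R * C + 1) * (t - s).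
  by rewrite mulrDl mul1r mulrA lerDl.
apply: le_trans NC; rewrite /force !summxE -sumrB.
apply: (le_trans (ler_norm_sum _ _ _)); apply: sum_edges_le => [|j Eij].
  by rewrite mulr_ge0.
have [edget _] := admissible_forever t0; have [edges _] := admissible_forever s0.
(* The gradient only depends on the difference of its two arguments. *)
have shift y z : enorm (y - z) < rhat -> grad psi y z = grad psi 0 (z - y) :> 'cV[R]_n.
  move=> yz; have yzE : 0 - (z - y) = y - z by rewrite sub0r opprB.
  by rewrite (grad_lam lamP yz) (grad_lam lamP) yzE.
rewrite (shift _ _ (edget _ _ Eij)) (shift _ _ (edges _ _ Eij)).
have inB w : enorm w < rhat -> forall l, `|(0 : 'cV[R]_n) l 0 - w l 0| <= B.
  move=> wr l; rewrite mxE sub0r normrN; apply: (le_trans (coord_enorm _ _)).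
  exact: le_trans (ltW wr) rhatB.
have wt : enorm (qh x j t - qh x i t) < rhat by rewrite enormC edget.
have ws : enorm (qh x j s - qh x i s) < rhat by rewrite enormC edges.
apply: (le_trans (hc (inB _ wt) (inB _ ws) k)).
have d l : `|(qh x j t - qh x i t) l 0 - (qh x j s - qh x i s) l 0| <= 2 * vmax * (t - s).
  have adm u : 0 <= u < t -> admissible u by case/andP => ? _; exact: admissible_forever.
  have := displacement_coord i l s0 st adm; have := displacement_coord j l s0 st adm.
  rewrite !colB !ler_distl => /andP[? ?] /andP[? ?]; apply/andP; split; lra.
rewrite /C -mulrA mulrDl; apply: lerD; apply: ler_wpM2l; rewrite ?(ltW hzeta) ?(ltW hvartheta)//.
apply: norm_le; first by rewrite !mulr_ge0.
by move=> l; have := d l; rewrite -colB.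
Qed.

(** The acceleration of the proxy is the opposite of the undelayed force up to
    vanishing terms, while its velocity vanishes. *)
Lemma force_vanishes i k : vanishes (fun t => force i t k 0).
Proof.
have [D D0 hD] := force_lipschitz i k.
have vNf : vanishes (fun t => - force i t k 0).
  apply: (barbalat_deriv D0 (velocity_vanishes i k)).
    by move=> s t s0 st; rewrite -opprD normrN hD.
  pose rem t := `|err G x i t k 0| + \sum_(j < N | E i j)
    (zeta + vartheta) * `|qh x j t - delayed i j t| + g_k G i * `|dqh x i t k 0|.
  have vrem : vanishes rem.
    apply: vanishesD; [apply: vanishesD|].
    - by apply: vanishes_norm; exact: error_vanishes.
    - apply: vanishes_sum => j Eij; apply: vanishesZ.
      exact: delayed_displacement_vanishes.
    - by apply: vanishesZ; apply: vanishes_norm; exact: velocity_vanishes.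
  move=> e /vrem[S hS]; exists (Num.max S 1) => t; rewrite ge_max => /andP[St t1].
  have t0 : 0 < t by exact: lt_le_trans t1.
  exists (acceleration i t k 0); first exact: velocity_der.
  apply: le_trans (hS t St); apply: le_trans (ler_norm _); rewrite opprK.
  rewrite /acceleration /force !colB !summxE.
  have -> (p1 p2 p3 p4 : R) : p1 - p2 - p3 + p4 = p1 + (p4 - p2) - p3 by ring.
  apply: (le_trans (ler_normB _ _)); apply: lerD; last first.
    by rewrite mxE normrM gtr0_norm.
  apply: (le_trans (ler_normD _ _)); apply: lerD.
    by rewrite [X in `|X|]mxE; apply: sat_contract; exact: (b_ge0 i).
  rewrite -sumrB; apply: (le_trans (ler_norm_sum _ _ _)); apply: ler_sum => j Eij.
  have adm u : 0 <= u <= t -> admissible u by case/andP => ? _; exact: admissible_forever.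
  have := grad_delay_bound k Eij (ltW t0) adm; rewrite colB => /le_trans; apply.
  rewrite mulrDl lerD2r; apply: ler_wpM2l; first exact: ltW.
  exact: coord_norm.
by move=> e /vNf[S hS]; exists S => t /hS; rewrite normrN.
Qed.

Lemma connected_ind (Q : 'I_N -> 'I_N -> Prop) : (forall i, Q i i) ->
  (forall i j l, E i j -> Q j l -> Q i l) -> forall i j, Q i j.
Proof.
move=> Q0 QE i j; have /connectP[p + ->] := hEconn i j.
by elim: p i => [|l p IH] i //= /andP[Eil /IH]; exact: QE.
Qed.

Lemma proxies_bounded i j : exists2 c, 0 <= c &
  forall t : R, 0 <= t -> enorm (qh x i t - qh x j t) <= c.
Proof.
move: i j; apply: connected_ind => [i|i j l Eij [c c1 hc']].
  by exists 0 => // t _; rewrite subrr enorm0.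
exists (rhat + c); first by rewrite addr_ge0// ltW.
move=> t t0; have [edge _] := admissible_forever t0.
rewrite -(subrK (qh x j t) (qh x i t)) -addrA; apply: (le_trans (enormD _ _)).
by apply: lerD; [exact: ltW (edge _ _ Eij) | exact: hc'].
Qed.

(** Virial identity: testing the forces against the positions relative to one
    proxy isolates a weighted sum of the edge lengths. *)
Lemma virial lam (t : R) :
  (forall d, 0 <= d < rhat -> 0 < lam d /\ slope psi d (lam d)) -> 0 <= t ->
  2 * \sum_(i < N) dot (qh x i t - qh x i0 t) (force i t) =
  \sum_(i < N) \sum_(j < N | E i j)
    rho lam (enorm (qh x i t - qh x j t)) * enorm (qh x i t - qh x j t).
Proof.
move=> lamP t0; have [edge _] := admissible_forever t0.
pose F i j := dot (qh x i t - qh x i0 t) (grad psi (qh x i t) (qh x j t)).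
have -> : \sum_(i < N) dot (qh x i t - qh x i0 t) (force i t) =
    \sum_(i < N) \sum_(j < N | E i j) F i j.
  by apply: eq_bigr => i _; rewrite /force dot_sumr.
rewrite mulr2n mulrDl mul1r {2}edge_sum_swap -big_split /=; apply: eq_bigr => i _.
rewrite -big_split /=; apply: eq_bigr => j Eij.
have ed : enorm (qh x j t - qh x i t) < rhat by rewrite enormC edge.
rewrite /F (grad_antisym ed) (grad_lam lamP) ?edge//.
rewrite dotNr -dotBl [X in dot X _](_ : _ = qh x i t - qh x j t); last first.
  by apply/colP => k; rewrite !mxE; ring.
by rewrite dotZr -sqr_enorm /rho; ring.
Qed.

Lemma edge_vanishes i j : E i j -> vanishes (fun t => enorm (qh x i t - qh x j t)).
Proof.
move=> Eij e e1; have [lam lamP] := potential_slope hpsi.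
have [h h0 gap] := edge_gap hpsi hc rhat0 rhatB hzeta hvartheta hmax k0 lyapunov0.
have short (t : R) : 0 <= t -> forall p l, E p l -> enorm (qh x p t - qh x l t) <= rhat - h.
  move=> t0; have [edge _] := admissible_forever t0.
  have edge' p l : E p l -> enorm (qh x p t - qh x l t) <= rhat by move=> /edge/ltW.
  apply: (gap (fun p => qh x p t)) => //; rewrite -Psi_clampedE//.
  exact: le_trans (coupling_energy_le t) (lyapunov_nonincreasing (lexx 0) t0).
(* Lengths in [e, rhat - h] stay where [rho] is bounded below; if that interval is
   empty the edge is already short. *)
have [eh|he] := leP e (rhat - h); last first.
  exists 0 => t t0; rewrite ger0_norm ?enorm_ge0//.
  exact: le_trans (short t t0 _ _ Eij) (ltW he).
have [|kap kap0 hkap] := rho_lower hc rhatB hzeta hvartheta lamP k0 e1 eh.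
  by rewrite ltrBlDr ltrDl.
have vS : vanishes (fun t => \sum_(p < N) dot (qh x p t - qh x i0 t) (force p t)).
  apply: vanishes_sum => p _; rewrite /dot; apply: vanishes_sum => k _.
  have [c c1 hc'] := proxies_bounded p i0.
  apply: (vanishes_le (T0 := 0) c1 _ (force_vanishes p k)) => t t0.
  rewrite normrM ler_wpM2r//; apply: (le_trans (coord_enorm _ _)); exact: (hc' t t0).
(* An edge longer than [e] contributes at least [kap e] to the virial. *)
have [|S hS] := vS (kap * e / 4); first by rewrite divr_gt0// mulr_gt0.
exists (Num.max S 0) => t; rewrite ge_max => /andP[/hS St t0].
rewrite ger0_norm ?enorm_ge0// leNgt; apply/negP => big.
have [edge _] := admissible_forever t0.
pose f p l := rho lam (enorm (qh x p t - qh x l t)) * enorm (qh x p t - qh x l t).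
have f0 p l : E p l -> 0 <= f p l.
  move=> Epl; rewrite !mulr_ge0 ?enorm_ge0//; apply: ltW.
  by apply: (lamP _ _).1; rewrite enorm_ge0 edge.
have fS : f i j <= \sum_(p < N) \sum_(l < N | E p l) f p l.
  rewrite (bigD1 i)//= (bigD1 j)//= -addrA lerDl addr_ge0//.
    by apply: sumr_ge0 => l /andP[El _]; exact: f0.
  by apply: sumr_ge0 => p _; apply: sumr_ge0 => l; exact: f0.
have fij : kap * e <= f i j.
  apply: ler_pM; rewrite ?(ltW kap0) ?(ltW e1) ?(ltW big)//.
  by apply: hkap; rewrite (ltW big) short.
have {}fS : f i j <= 2 * \sum_(p < N) dot (qh x p t - qh x i0 t) (force p t).
  by rewrite (virial lamP t0).
have : 0 < kap * e by rewrite mulr_gt0.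
have := le_trans (ler_norm (\sum_(p < N) dot (qh x p t - qh x i0 t) (force p t))) St.
have := le_trans fij fS; lra.
Qed.

Lemma proxies_consensus i j : vanishes (fun t => enorm (qh x i t - qh x j t)).
Proof.
move: i j; apply: connected_ind => [i|i j l Eij hv].
  by apply: (vanishes_near (T0 := 0) _ vanishes0) => t _; rewrite subrr enorm0.
apply: (vanishes_le (c := 1) (T0 := 0) _ _ (vanishesD (edge_vanishes Eij) hv)) => // t _.
rewrite mul1r !ger0_norm ?addr_ge0 ?enorm_ge0//.
by rewrite -{1}(subrK (qh x j t) (qh x i t)) -addrA enormD.
Qed.

Lemma agent_proxy_vanishes i : vanishes (fun t => `|q x i t - qh x i t|).
Proof.
have v : vanishes (fun t => \sum_k `|err G x i t k 0|).
  by apply: vanishes_sum => k _; apply: vanishes_norm; exact: error_vanishes.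
apply: (vanishes_le (c := (g_p G i)^-1) (T0 := 0) _ _ v) => [|t _].
  by rewrite invr_ge0 ltW.
have -> : q x i t - qh x i t = (g_p G i)^-1 *: err G x i t.
  by rewrite /err scalerA mulVf ?scale1r// gt_eqF.
rewrite normr_id normrZ gtr0_norm ?invr_gt0//; apply: ler_wpM2l.
  by rewrite invr_ge0 ltW.
rewrite ger0_norm ?sumr_ge0//; apply: norm_le; first by rewrite sumr_ge0.
by move=> k; rewrite (bigD1 k)//= lerDl sumr_ge0.
Qed.

Lemma agents_consensus i j : vanishes (fun t => `|q x i t - q x j t|).
Proof.
have v := vanishesD (vanishesD (agent_proxy_vanishes i) (proxies_consensus i j))
  (agent_proxy_vanishes j).
apply: (vanishes_le (c := 1) (T0 := 0) _ _ v) => // t _.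
rewrite mul1r normr_id [leRHS]ger0_norm ?addr_ge0 ?enorm_ge0//.
have -> : q x i t - q x j t =
    (q x i t - qh x i t) + (qh x i t - qh x j t) - (q x j t - qh x j t).
  by apply/colP => k; rewrite !mxE; ring.
apply: (le_trans (ler_normB _ _)); rewrite lerD2r.
apply: (le_trans (ler_normD _ _)); rewrite lerD2l; exact: norm_le_enorm.
Qed.

End LyapunovAnalysis.


(** * Extension of the trajectories before time 0 *)

Section Extension.
Context {R : realType} {W : normedModType R}.

Lemma continuous_extension (f : R -> W) : {within `[0, +oo[, continuous f} ->
  continuous (fun t : R => f (Num.max 0 t)).
Proof.
move=> cf t; pose cl (u : R) := Num.max 0 u.
have clI u : cl u \in `[0, +oo[ by rewrite in_itv/= /cl le_max lexx.
have ccl : {for t, continuous cl}.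
  by apply: (@continuous_max _ _ (fun=> 0) id) => //; exact: cst_continuous.
have /subspace_continuousP/(_ (cl t) (clI t)) cp := cf.
apply/cvgrPdist_lt => e e0; move/cvgrPdist_lt : cp => /(_ _ e0) H.
have {}H : \forall s \near cl t, s \in `[0, +oo[ -> `|f (cl t) - f s| < e by exact: H.
have K : \forall u \near t, cl u \in `[0, +oo[ -> `|f (cl t) - f (cl u)| < e := ccl _ H.
by near=> u; have : cl u \in `[0, +oo[ -> `|f (cl t) - f (cl u)| < e; [near: u|exact].
Unshelve. all: by end_near. Qed.

Lemma is_derive_extension (f : R -> W) (t : R) (d : W) : 0 < t ->
  is_derive t (1 : R) f d -> is_derive t (1 : R) (fun u : R => f (Num.max 0 u)) d.
Proof.
move=> t0; apply: near_eq_is_derive; near=> u.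
by rewrite max_r// ltW//; near: u; exact: lt_nbhsr.
Unshelve. all: by end_near. Qed.

End Extension.

Section RestExtension.
Context {R : realType} {N n : nat} {m : 'I_N -> nat}.

(** The trajectory that rests in its initial state before time [0]. *)
Definition rest_extension (x : trajectory R n m) : trajectory R n m := Trajectory
  (fun i t => q x i (Num.max 0 t)) (fun i t => dq x i (Num.max 0 t))
  (fun i t => qh x i (Num.max 0 t)) (fun i t => dqh x i (Num.max 0 t))
  (fun i t => thh x i (Num.max 0 t)).

Lemma rest_extension_loop (A : forall i : 'I_N, el_agent R n (m i))
    (thlo thup : forall i : 'I_N, 'cV[R]_(m i)) (delta : R)
    (fbar eta : 'I_N -> 'cV[R]_n) (E : rel 'I_N) (T : 'I_N -> 'I_N -> R -> R)
    (psi : R -> R) (G : gains R N) (x : trajectory R n m) :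
  closed_loop A thlo thup delta fbar eta E T psi G x ->
  closed_loop A thlo thup delta fbar eta E T psi G (rest_extension x).
Proof.
move=> hx; have maxE (t : R) : 0 < t -> Num.max 0 t = t by move=> /ltW; exact: max_r.
have max00 : Num.max 0 0 = 0 :> R by rewrite maxxx.
split => /=.
- move=> i; have [h1 h2 h3 h4 h5] := cl_cont hx i.
  by split; apply: continuous_subspaceT; exact: continuous_extension.
- move=> i t t0; rewrite maxE//; apply: is_derive_extension => //; exact: (cl_q hx).
- move=> i t t0; have [ddq d1 d2] := cl_dq hx i t0; exists ddq.
    exact: is_derive_extension.
  by rewrite /fhat /surf /Phi /err /derr /= !maxE.
- move=> i t t0; rewrite maxE//; apply: is_derive_extension => //; exact: (cl_qh hx).
- move=> i t t0; apply: is_derive_extension => //.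
  rewrite /err /= !maxE//.
  have -> : \sum_(j < N | E i j) grad psi (qh x i t) (qh x j (Num.max 0 (t - T j i t))) =
      \sum_(j < N | E i j) grad psi (qh x i t) (qh x j (t - T j i t)).
    apply: eq_bigr => j _; congr (grad _ _ _).
    by case: (lerP 0 (t - T j i t)) => // /(cl_past hx).
  exact: (cl_dqh hx).
- move=> i t t0; apply: is_derive_extension => //.
  rewrite /omega /surf /Phi /err /derr /= !maxE//; exact: (cl_thh hx).
- by move=> i; rewrite max00; exact: (cl_qh0 hx).
- by move=> i; rewrite max00; exact: (cl_dqh0 hx).
- by move=> i; rewrite max00; exact: (cl_thh0 hx).
- by move=> i t /ltW t0; rewrite (max_l t0) max00.
Qed.

End RestExtension.

(* MathComp-Analysis world *)
Theorem mainTheorem8 (R : realType) (N n : nat) (m : 'I_N -> nat)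
  (A : forall i : 'I_N, el_agent R n (m i))
  (thlo thup : forall i : 'I_N, 'cV[R]_(m i)) (delta : R)
  (fbar eta : 'I_N -> 'cV[R]_n)
  (E : rel 'I_N) (T : 'I_N -> 'I_N -> R -> R) (Tbar : 'I_N -> 'I_N -> R)
  (r eps rhat Psimax : R) (psi : R -> R) (B zeta vartheta a : R)
  (upsilon : 'I_N -> R) (G : gains R N) (x : trajectory R n m)
  (* agents and parameter bounds *)
  (hG : gains_pos G)
  (hA : forall i, el_properties (A i) (g_alpha G))
  (hdelta : 0 < delta)
  (hwidth : forall i k, delta < 2^-1 * (thup i k 0 - thlo i k 0))
  (htheta : forall i k,
     thlo i k 0 + delta <= param (A i) k 0 <= thup i k 0 - delta)
  (* delays *)
  (hT : forall i j (t : R), E i j -> 0 <= t -> 0 <= T j i t <= Tbar j i)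
  (* closed loop *)
  (hx : closed_loop A thlo thup delta fbar eta E T psi G x)
  (* (1) *)
  (hr : 0 < r) (heps : 0 < eps)
  (hEsym : symmetric E) (hEirr : irreflexive E)
  (hEconn : forall i j, connect E i j)
  (hE0 : forall i j, E i j -> enorm (q x i 0 - q x j 0) <= r - eps)
  (* (2) *)
  (hrest : forall i, dq x i 0 = 0)
  (* (3) *)
  (heta : forall i k, 0 <= eta i k 0 < fbar i k 0)
  (hPhi : forall i k (t : R), 0 <= t ->
     `|(Phi A G x i t *m thh x i t) k 0| <= eta i k 0)
  (* (4) *)
  (hrhat : rhat = r - 2 * eps / 3)
  (hPsimax : Psimax = phi_star (fun i => fbar i - eta i) (g_p G) eps)
  (hpsi : potential rhat psi)
  (hbnd : exists K : R, forall y : 'I_N -> 'cV[R]_n,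
     (forall i j, E i j -> enorm (y i - y j) <= rhat) -> Psi E psi y <= K)
  (hmax : forall y : 'I_N -> 'cV[R]_n,
     (forall i j, E i j -> enorm (y i - y j) <= rhat) ->
     (exists i j, E i j /\ enorm (y i - y j) = rhat) -> Psimax <= Psi E psi y)
  (hPsi0 : Psi E psi (fun i => qh x i 0) < Psimax)
  (* (5) *)
  (hzeta : 0 < zeta) (hvartheta : 0 < vartheta)
  (hB : forall i j, E i j -> rhat + Tbar j i * Num.sqrt (2 * Psimax) <= B)
  (hc : grad_bound n psi B zeta vartheta)
  (ha : 0 < a) (hups : forall i, 0 < upsilon i)
  (hk : forall i, g_k G i >=
     \sum_(j < N | E i j) (a * (zeta + vartheta) / 2
        + (zeta + n%:R * vartheta) * Tbar i j ^+ 2 / (2 * a)) + upsilon i)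
  (* (6) *)
  (hbeta : \sum_(i < N) (2 * g_beta G i)^-1
       * ((param (A i) - thh x i 0)^T *m (param (A i) - thh x i 0)) 0 0
     < Psimax - Psi E psi (fun i => qh x i 0)) :
  (forall i j (t : R), 0 <= t -> E i j -> enorm (q x i t - q x j t) < r) /\
  (forall i j, (q x i t - q x j t) @[t --> +oo] --> (0 : 'cV[R]_n)).
Proof.
(* Replace the trajectory by its rest extension, which agrees with it from time 0 on
   and is continuous on the whole line. *)
have hx' := rest_extension_loop hx.
set y := rest_extension x in hx'.
have max00 : Num.max 0 0 = 0 :> R by rewrite maxxx.
have yE i (t : R) : 0 <= t -> q y i t = q x i t by move=> t0; rewrite /= max_r.
have qh0 : (fun i => qh y i 0) = (fun i => qh x i 0).
  by apply/funext => i; rewrite /= max00.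
have hE0' i j : E i j -> enorm (q y i 0 - q y j 0) <= r - eps.
  by rewrite /= max00; exact: hE0.
have hrest' i : dq y i 0 = 0 by rewrite /= max00.
have hPhi' i k (t : R) : 0 <= t -> `|(Phi A G y i t *m thh y i t) k 0| <= eta i k 0.
  move=> t0; have := hPhi i k t t0.
  by rewrite /Phi /err /derr /= !(max_r t0).
have hbeta' : \sum_(i < N) (2 * g_beta G i)^-1
       * ((param (A i) - thh y i 0)^T *m (param (A i) - thh y i 0)) 0 0
     < Psimax - Psi E psi (fun i => qh y i 0).
  by rewrite qh0 /= max00.
have cont i : [/\ continuous (q y i), continuous (dq y i), continuous (qh y i),
    continuous (dqh y i) & continuous (thh y i)].
  have [h1 h2 h3 h4 h5] := cl_cont hx i.
  by split; exact: continuous_extension.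
have cq i : continuous (q y i) by case: (cont i).
have cdq i : continuous (dq y i) by case: (cont i).
have cqh i : continuous (qh y i) by case: (cont i).
have cdqh i : continuous (dqh y i) by case: (cont i).
have cthh i : continuous (thh y i) by case: (cont i).
have qh_past i (t : R) : t <= 0 -> qh y i t = qh y i 0.
  by move=> t0; rewrite /= (max_l t0) max00.
have dqh_past i (t : R) : t <= 0 -> dqh y i t = 0.
  by move=> t0; rewrite /= (max_l t0); exact: (cl_dqh0 hx).
have [n0|n0] := posnP n.
  have v0 (v : 'cV[R]_n) : v = 0 by apply/colP => k; have := ltn_ord k; rewrite {2}n0.
  split=> [i j t _ _|i j]; first by rewrite (v0 (_ - _)) enorm0.
  rewrite (_ : (fun t => q x i t - q x j t) = fun=> 0); first exact: cvg_cst.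
  by apply/funext => t; exact: v0.
pose k0 := Ordinal n0.
split=> [i j t t0 Eij|i j].
  rewrite -!(yE _ _ t0).
  exact: (connectivity hG hA hdelta htheta hT hx' heps hEsym hE0' hrest' heta
    hPhi' hrhat hPsimax hpsi hmax hzeta hvartheta hB hc ha hups hk hbeta' cq cdq cqh cdqh cthh qh_past dqh_past
    Eij t0 Eij).
have [<-|ij] := eqVneq i j.
  rewrite (_ : (fun t => q x i t - q x i t) = fun=> 0); first exact: cvg_cst.
  by apply/funext => t; rewrite subrr.
have [l Eil] : exists l, E i l.
  have /connectP[[|l p] /= + e] := hEconn i j; first by rewrite e eqxx in ij.
  by case/andP=> Eil _; exists l.
have v : vanishes (fun t => `|q y i t - q y j t|).
  exact: (agents_consensus hG hA hdelta htheta hT hx' heps hEsym hEconn hE0' hrest' heta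
    hPhi' hrhat hPsimax hpsi hmax hzeta hvartheta hB hc ha hups hk hbeta' cq cdq cqh cdqh cthh qh_past dqh_past
    Eil k0 i j).
apply/cvgrPdist_le => e /v[S hS]; near=> t.
have /andP[St t0] : (S <= t) && (0 <= t).
  by apply/andP; split; near: t; apply: nbhs_pinfty_ge; rewrite num_real.
by rewrite sub0r normrN -!(yE _ _ t0) -[leLHS]normr_id; exact: hS.
Unshelve. all: by end_near. Qed.
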